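(* Assume that a reference measure for $X$ exists, that every semipolar set in $\mathcal B$ is polar (Hunt's hypothesis), and that $\mathbb E^x[\sup_{t\in[0,\infty]}\delta(t)f(X_t)]<\infty$ for all $x\in\mathbb R^d$. Then, for any $R\in\mathcal B$ with $\Theta(R)\subseteq R$, the set $R\setminus\Theta(R)$ is polar and $\Theta(\Theta(R))=\Theta(R)$, i.e. $\Theta(R)\in\mathcal E$. In addition, if $R$ is finely closed, so is $\Theta(R)$.
   Context: Setting. $\mathcal B$ is the Borel $\sigma$-algebra of $\mathbb R^d$. $X=(X_t)_{t\ge0}$ is an $\mathbb R^d$-valued time-homogeneous continuous strong Markov process with transition function $(P_t)_{t\ge 0}$, realized on the path space $C([0,\infty);\mathbb R^d)$ with the universally completed filtration $\mathbb F$ (the intersection over all initial laws $\mu$ of the $\mu$-augmentations of the raw filtration generated by $X$); $\mathbb P^x,\mathbb E^x$ denote the law and expectation when $X_0=x$. The payoff $f:\mathbb R^d\to[0,\infty)$ is continuous. The discount function $\delta:[0,\infty)\to[0,1]$ is continuous, nonincreasing, with $\delta(0)=1$, $\lim_{t\to\infty}\delta(t)=0$, and $\delta(s)\delta(t)\le\delta(s+t)$ for all $s,t>0$. Convention: $\delta(\infty)f(X_\infty):=\limsup_{t\to\infty}\delta(t)f(X_t)$. Stopping policies and equilibria. For $R\in\mathcal B$, $\rho_R:=\inf\{t>0:X_t\in R\}$ ($\inf\emptyset=\infty$), $J(x,R):=\mathbb E^x[\delta(\rho_R)f(X_{\rho_R})]$, $S(R):=\{x:J(x,R)<f(x)\}$,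 $I(R):=\{x:J(x,R)=f(x)\}$, $\Theta(R):=S(R)\cup(I(R)\cap R)$. $R\in\mathcal B$ is an equilibrium if $\Theta(R)=R$; $\mathcal E$ is the set of all equilibria. Potential theory. $R\in\mathcal B$ is of zero potential if $\int_0^\infty P_t(x,R)\,dt=0$ for all $x\in\mathbb R^d$. A reference measure for $X$ is a measure $\lambda$ on $(\mathbb R^d,\mathcal B)$ that is a countable sum of finite measures and such that $R\in\mathcal B$ is of zero potential if and only if $\lambda(R)=0$. For $R\in\mathcal B$, $R^r:=\{x:\rho_R=0\ \mathbb P^x\text{-a.s.}\}$ is the set of regular points to $R$, $R^*:=R\cup R^r$ is the fine closure of $R$, and $R$ is finely closed if $R=R^*$. $R\in\mathcal B$ is polar if $\rho_R=\infty$ $\mathbb P^x$-a.s. for all $x\in\mathbb R^d$, thin if $R^r=\emptyset$, and semipolar if it is a countable union of thin sets. *)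

(* Defs.v *)
From HB Require Import structures.
From mathcomp Require Import all_boot all_order all_algebra.
From mathcomp Require Import all_classical all_reals all_analysis.

Set Implicit Arguments.
Unset Strict Implicit.
Unset Printing Implicit Defensive.

Import Order.TTheory GRing.Theory Num.Theory.
Import numFieldNormedType.Exports.

Local Open Scope classical_set_scope.
Local Open Scope ring_scope.
Local Open Scope ereal_scope.

Definition Rd (R : realType) (d : nat) := g_sigma_algebraType (@open 'rV[R]_d).

(* C([0, oo); R^d). A path is a function on all of R that is continuous on
   [0, oo) and frozen at its initial value on (-oo, 0): restriction to [0, oo)
   is then a bijection onto C([0, oo); R^d). *)
Record path_space (R : realType) (d : nat) := Path {
  path_fun :> R -> 'rV[R]_d ;
  path_continuous : {within `[0%R, +oo[, continuous path_fun} ;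
  path_before0 : forall t : R, (t < 0)%R -> path_fun t = path_fun 0%R }.

Section paths.
Context (R : realType) (d : nat).
Local Notation Omega := (path_space R d).

Fact cst_path_continuous :
  {within `[0%R : R, +oo[, continuous (fun=> 0%R : 'rV[R]_d)}.
Proof. by apply: continuous_subspaceT => x; exact: cvg_cst. Qed.

Definition cst_path : Omega :=
  @Path R d (fun=> 0%R) cst_path_continuous (fun _ _ => erefl).

HB.instance Definition _ := gen_eqMixin Omega.
HB.instance Definition _ := gen_choiceMixin Omega.
HB.instance Definition _ := isPointed.Build Omega cst_path.

(* The events {X_t \in B} with t in T and B Borel, X being the coordinate
   process X_t(w) = w t. *)
Definition cylinders (T : set R) : set_system Omega :=
  [set C | exists2 t, T t &
     exists2 B : set (Rd R d), measurable B & C = [set w : Omega | B (w t)]].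

Let path_measurable : set_system Omega := <<s cylinders `[0%R, +oo[ >>.

Let path_measurable0 : path_measurable set0.
Proof. exact: sigma_algebra0. Qed.

Let path_measurableC (A : set Omega) :
  path_measurable A -> path_measurable (~` A).
Proof. exact: sigma_algebraC. Qed.

Let path_measurableU (F : (set Omega)^nat) :
  (forall i, path_measurable (F i)) -> path_measurable (\bigcup_i F i).
Proof. exact: sigma_algebra_bigcup. Qed.

Definition path_display : measure_display. Proof. by constructor. Qed.

HB.instance Definition _ := @isMeasurable.Build path_display Omega
  path_measurable path_measurable0 path_measurableC path_measurableU.

Definition raw_filtration (t : R) : set_system Omega :=
  <<s cylinders `[0%R, t] >>.

End paths.

Section laws.
Context (R : realType) (d : nat) (P : R.-pker (Rd R d) ~> (path_space R d)).
Local Notation E := (Rd R d).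
Local Notation Omega := (path_space R d).

(* P^mu, the law of X when X_0 has law mu. *)
Definition law (mu : probability E R) (A : set Omega) : \bar R :=
  \int[mu]_x P x A.

Section law_measure.
Variable mu : probability E R.

Let law0 : law mu set0 = 0.
Proof. by apply: integral0_eq => x _; rewrite measure0. Qed.

Let law_ge0 A : 0 <= law mu A.
Proof. by apply: integral_ge0 => x _; exact: measure_ge0. Qed.

Let law_sigma_additive : semi_sigma_additive (law mu).
Proof.
move=> F mF tF mUF; rewrite /law.
rewrite (_ : (fun n => _) =
    (fun n => \int[mu]_x \sum_(0 <= i < n) P x (F i))); last first.
  apply/funext => n; rewrite ge0_integral_sum// => i.
  exact: measurable_kernel.
rewrite (_ : \int[mu]_x _ = \int[mu]_x \sum_(0 <= i <oo) P x (F i)); last first.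
  by apply: eq_integral => x _; rewrite measure_semi_bigcup.
apply: cvg_monotone_convergence => //.
- by move=> n; apply: emeasurable_sum => i _; exact: measurable_kernel.
- by move=> n x _; apply: sume_ge0.
- by move=> x _ m n mn; apply: lee_sum_nneg_natr.
Qed.

HB.instance Definition _ :=
  isMeasure.Build _ _ _ (law mu) law0 law_ge0 law_sigma_additive.

End law_measure.

(* The universal completion of G: the intersection over all initial laws mu of
   the mu-augmentations of G. *)
Definition universal_completion (G : set_system Omega) : set_system Omega :=
  [set C | forall mu : probability E R, <<s G `|` (law mu).-negligible >> C].

Definition filtration (t : R) : set_system Omega :=
  universal_completion (@raw_filtration R d t).

Definition filtration_right (t : R) : set_system Omega :=
  \bigcap_(s in `]t, +oo[) filtration s.

Definition stopping_time (tau : Omega -> \bar R) : Prop :=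
  (forall w, 0 <= tau w) /\
  (forall t : R, (0 <= t)%R -> filtration_right t [set w | tau w <= t%:E]).

Definition stopped_events (tau : Omega -> \bar R) : set_system Omega :=
  [set C | universal_completion (@measurable _ Omega) C /\
     forall t : R, (0 <= t)%R ->
       filtration_right t (C `&` [set w | tau w <= t%:E])].

(* P^x on its completed sigma-algebra, so that hitting times of Borel sets,
   which need not be Borel functions of the path, can be integrated. *)
Local Notation Pbar x := (@completed_measure_extension _ _ _ (P x)).

Definition completed_expectation (x : E) (Y : Omega -> \bar R) : \bar R :=
  \int[Pbar x]_w Y w.

Definition transition_function (Pt : R -> R.-pker E ~> E) : Prop :=
  (forall (x : E) (B : set E), measurable B -> Pt 0%R x B = \d_x B) /\
  (forall (s t : R) (x : E) (B : set E), (0 <= s)%R -> (0 <= t)%R ->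
     measurable B -> Pt (s + t)%R x B = \int[Pt s x]_y Pt t y B).

(* P^x[C, tau < oo, X_(tau+t) \in B] = E^x[1_C 1_(tau < oo) P_t(X_tau, B)] for
   all C \in F_tau, i.e., P^x[X_(tau+t) \in B | F_tau] = P_t(X_tau, B) on
   {tau < oo}. Stopping times and F_tau refer to (F_(t+))_t, as in the usual
   definition of the strong Markov property (one then has F_(t+) = F_t). *)
Definition strong_markov_process (Pt : R -> R.-pker E ~> E) : Prop :=
  [/\ transition_function Pt,
      (forall x : E, {ae P x, forall w : Omega, w 0%R = x}) &
      forall (x : E) (tau : Omega -> \bar R) (C : set Omega) (t : R)
             (B : set E),
        stopping_time tau -> stopped_events tau C -> (0 <= t)%R ->
        measurable B ->
        Pbar x (C `&` [set w | tau w < +oo]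
                  `&` [set w : Omega | B (w (fine (tau w) + t)%R)]) =
        \int[Pbar x]_(w in C `&` [set w | tau w < +oo])
           Pt t (w (fine (tau w))) B].

Definition hitting_time (A : set E) (w : Omega) : \bar R :=
  ereal_inf [set t%:E | t in [set t : R | (0 < t)%R /\ A (w t)]].

Definition regular_points (A : set E) : set E :=
  [set x | {ae P x, forall w, hitting_time A w = 0}].

Definition finely_closed (A : set E) : Prop :=
  measurable A /\ A = A `|` regular_points A.

Definition polar (A : set E) : Prop :=
  measurable A /\ forall x : E, {ae P x, forall w, hitting_time A w = +oo}.

Definition thin (A : set E) : Prop :=
  measurable A /\ regular_points A = set0.

Definition semipolar (A : set E) : Prop :=
  exists2 F : (set E)^nat, (forall n, thin (F n)) & A = \bigcup_n F n.

Definition zero_potential (Pt : R -> R.-pker E ~> E) (A : set E) : Prop :=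
  measurable A /\
  forall x : E, \int[lebesgue_measure]_(t in `[0%R, +oo[) Pt t x A = 0.

(* The countable sum of finite measures is the library's s-finiteness. *)
Definition reference_measure (Pt : R -> R.-pker E ~> E)
    (lambda : {sfinite_measure set E -> \bar R}) : Prop :=
  forall A : set E, measurable A -> (zero_potential Pt A <-> lambda A = 0).

End laws.

Definition discount_function (R : realType) (delta : R -> R) : Prop :=
  [/\ {within `[0%R, +oo[, continuous delta},
      (forall t, 0 <= t -> 0 <= delta t <= 1)%R,
      (forall s t, 0 <= s -> s <= t -> delta t <= delta s)%R,
      delta 0%R = 1%R /\ delta t @[t --> +oo%R] --> 0%R &
      (forall s t, 0 < s -> 0 < t -> delta s * delta t <= delta (s + t))%R].

Section stopping_policies.
Context (R : realType) (d : nat) (P : R.-pker (Rd R d) ~> (path_space R d)).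
Context (f : 'rV[R]_d -> R) (delta : R -> R).
Local Notation E := (Rd R d).
Local Notation Omega := (path_space R d).

(* delta(t) f(X_t) for t \in [0, oo], with the limsup convention at t = oo;
   the value at -oo is irrelevant. *)
Definition discounted_payoff (t : \bar R) (w : Omega) : \bar R :=
  match t with
  | r%:E => (delta r * f (w r))%:E
  | +oo => limf_esup (fun r : R => (delta r * f (w r))%:E) +oo%R
  | -oo => 0
  end.

Definition J (x : E) (A : set E) : \bar R :=
  completed_expectation P x (fun w => discounted_payoff (hitting_time A w) w).

Definition stopping_region (A : set E) : set E :=
  [set x | J x A < (f x)%:E].

Definition indifference_region (A : set E) : set E :=
  [set x | J x A = (f x)%:E].

Definition Theta (A : set E) : set E :=
  stopping_region A `|` (indifference_region A `&` A).

Definition equilibrium (A : set E) : Prop := measurable A /\ Theta A = A.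

End stopping_policies.

(* Main.v *)
(* Every point of A that is regular for A is indifferent, so A \ Theta A is
   contained in the set A \ A^r of irregular points of A. It thus suffices that
   A \ A^r is semipolar, hence polar: the hitting times of Theta A and of A are
   then almost surely equal, and so are J(x, Theta A) and J(x, A).

   Measurability rests on one fact: when a reference measure exists, a Borel set
   A contains an F_sigma set A' with the same hitting time almost surely under
   every P^x. For one initial law, A' comes from Choquet's capacitability theorem,
   applied to the outer probability that the path meets a set during a compact
   time interval; two sets with the same hitting time from almost every point for
   the reference measure have the same hitting time from every point, because
   P_t(x, .) does not charge a given null set for almost every t.

   The irregular points of A are those of the sets
   {y in A : P^y(rho_A < eta) <= 1 - eta}, eta = 1/(n+1). Such a set is thin:
   otherwise the strong Markov property at a small hitting time T of one of its
   closed subsets bounds P^(X_(T+t))(rho_A < eta/2) by 1 - eta on average; after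
   averaging over t the shift by T is negligible, which contradicts
   P_t(x, P^.(rho_A < eta/2)) --> 1 as t --> 0 at a regular point x. *)

From HB Require Import structures.
Require Import Defs.
From mathcomp Require Import all_boot all_order all_algebra.
From mathcomp Require Import all_classical all_reals all_analysis.
From mathcomp Require Import measurable_realfun borel_hierarchy lra.
Import Order.TTheory GRing.Theory Num.Theory.
Import numFieldNormedType.Exports.
Local Open Scope classical_set_scope.
Local Open Scope ring_scope.
Local Open Scope ereal_scope.

Set Implicit Arguments.
Unset Strict Implicit.
Unset Printing Implicit Defensive.

(** * Souslin sets and capacitability *)

(** Dependent choice along finite sequences. It serves twice for capacitability: to choose the
    bounds [m], and to follow a branch in Koenig's argument. *)
Lemma prefix_choice (P : seq nat -> Prop) :
  P [::] -> (forall l, P l -> exists n, P (rcons l n)) ->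
  exists m : nat -> nat, forall k, P (mkseq m k).
Proof.
move=> P0 PS.
have /choice[g gP] l : exists n, P l -> P (rcons l n).
  have [/PS[n Pn]|nP] := pselect (P l); first by exists n.
  by exists 0%N.
pose pre := fix pre k := if k is k'.+1 then rcons (pre k') (g (pre k')) else [::].
exists (fun k => g (pre k)) => k.
have -> : mkseq (fun k => g (pre k)) k = pre k.
  elim: k => // k IH.
  by rewrite mkseqS IH.
by elim: k => //= k /gP.
Qed.

(** The Souslin operation on closed sets. The scheme is indexed by infinite sequences, of which
    level [k] reads the first [k] entries only. *)
Definition souslin (T : topologicalType) (A : set T) : Prop :=
  exists C : nat -> (nat -> nat) -> set T,
    [/\ forall k s, closed (C k s),
        forall k s t, (forall j, (j < k)%N -> s j = t j) -> C k s = C k t &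
        A = [set x | exists s, forall k, C k s x]].

(** Level [n] of the new scheme intersects those [C k] with [k] and [N k] at most [n], so it reads
    no entry beyond the first [n]. *)
Lemma souslinW (T : topologicalType) (C : nat -> (nat -> nat) -> set T)
    (N : nat -> nat) :
  (forall k s, closed (C k s)) ->
  (forall k s t, (forall j, (j < N k)%N -> s j = t j) -> C k s = C k t) ->
  souslin [set x | exists s, forall k, C k s x].
Proof.
move=> Ccl CN.
exists (fun n s => \bigcap_(k in [set k | (k <= n)%N /\ (N k <= n)%N]) C k s).
split.
- by move=> k s; apply: closed_bigI => i _; exact: Ccl.
- move=> k s t st; apply: eq_bigcapr => i [ik Nik].
  by apply: CN => j jN; apply: st; exact: leq_trans Nik.
- apply/seteqP; split=> x /= [s sx]; exists s => k.
    by move=> i _; exact: sx.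
  by apply: (sx (maxn k (N k))); split; rewrite ?leq_maxl ?leq_maxr.
Qed.

Lemma souslin_closed (T : topologicalType) (A : set T) : closed A -> souslin A.
Proof.
move=> Acl; exists (fun _ _ => A); split=> //.
by apply/seteqP; split=> x /= => [Ax|[_ /(_ 0%N)]//]; exists id.
Qed.

(** The first entry of a branch names the index [n]; the remaining ones form a branch for [F n]. *)
Lemma souslin_bigcup (T : topologicalType) (F : nat -> set T) :
  (forall n, souslin (F n)) -> souslin (\bigcup_n F n).
Proof.
move=> /choice[C CP].
exists (fun k s => if k is k'.+1 then C (s 0%N) k' (fun j => s j.+1) else setT).
split.
- by move=> [|k] s; [exact: closedT | case: (CP (s 0%N)) => + _ _; exact].
- move=> [|k] s t st //; rewrite (st 0%N)//.
  by have [_ + _] := CP (t 0%N); apply=> j jk; exact: st.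
- apply/seteqP; split=> x.
    move=> [n _]; have [_ _ ->] := CP n; move=> -[s sx].
    by exists (fun j => if j is j'.+1 then s j' else n) => -[|k].
  move=> /= [s sx]; exists (s 0%N) => //; have [_ _ ->] := CP (s 0%N).
  by exists (fun j => s j.+1) => k; exact: (sx k.+1).
Qed.

(** A single sequence codes one branch per index through the pairing [pickle (i, j)]. When [m] codes
    [(i, k)], level [m] checks condition [k] for [F i]. *)
Lemma souslin_bigcap (T : topologicalType) (F : nat -> set T) :
  (forall n, souslin (F n)) -> souslin (\bigcap_n F n).
Proof.
move=> /choice[C CP].
pose D m s := if unpickle m is Some (i, k)
  then C i k (fun j => s (pickle (i, j))) else setT.
pose N m := if (unpickle m : option (nat * nat)) is Some (i, k)
  then \max_(j < k) (pickle (i, nat_of_ord j)).+1 else 0%N.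
have -> : \bigcap_n F n = [set x | exists s, forall k, D k s x].
  apply/seteqP; split=> x /=.
    move=> Fx.
    have /choice[S SP] n : exists s, forall k, C n k s x.
      by have := Fx n I; have [_ _ {1}->] := CP n.
    exists (fun m => if unpickle m is Some (i, j) then S i j else 0%N) => m.
    rewrite /D; case: unpickle => // -[i k]; have := SP i k.
    by congr (C i k _ x); apply/funext => j; rewrite pickleK.
  move=> [s sx] n _; have [_ _ ->] := CP n.
  by exists (fun j => s (pickle (n, j))) => k; have := sx (pickle (n, k));
    rewrite /D pickleK.
apply: (@souslinW _ D N) => m.
  move=> s; rewrite /D; case: unpickle => [[i k]|]; last exact: closedT.
  by have [+ _ _] := CP i; exact.
move=> s t; rewrite /N /D; case: unpickle => // -[i k] st.
have [_ + _] := CP i; apply=> j jk; apply: st.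
exact: (leq_bigmax (Ordinal jk)).
Qed.

(** The Souslin sets with Souslin complement form a sigma-algebra, which contains the open sets
    because these are F_sigma. *)
Lemma souslin_borel (T : topologicalType) (A : set T) :
  (forall U : set T, open U ->
    exists2 F : nat -> set T, (forall n, closed (F n)) & U = \bigcup_n F n) ->
  <<s open >> A -> souslin A.
Proof.
move=> oF sA; suff [] : souslin A /\ souslin (~` A) by [].
pose S := [set B : set T | souslin B /\ souslin (~` B)].
suff : <<s open >> `<=` S by apply.
apply: smallest_sub; last first.
  move=> U oU; split; last by apply: souslin_closed; exact: open_closedC.
  by have [F Fcl ->] := oF _ oU; apply: souslin_bigcup => n; exact: souslin_closed.
split.
- by split; apply: souslin_closed; [exact: closed0 | rewrite setC0; exact: closedT].
- by move=> B [? ?]; split; rewrite setTD// setCK.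
- move=> F FS; split; first by apply: souslin_bigcup => n; have [] := FS n.
  by rewrite setC_bigcup; apply: souslin_bigcap => n; have [] := FS n.
Qed.

(* The branch found by Koenig's lemma shows that [L] lies in [A]; the choice of [m]
   keeps every [L k] large, so that [L] is large by continuity along closed
   sets. *)
Theorem choquet_capacitability (T : topologicalType) (R : realType)
    (I : set T -> \bar R) (c : \bar R) :
  (forall A B, A `<=` B -> I A <= I B) ->
  (forall F : nat -> set T, (forall n, F n `<=` F n.+1) ->
    c < I (\bigcup_n F n) -> exists n, c < I (F n)) ->
  (forall F : nat -> set T, (forall n, closed (F n)) ->
    (forall n, F n.+1 `<=` F n) -> (forall n, c <= I (F n)) ->
    c <= I (\bigcap_n F n)) ->
  forall A, souslin A -> c < I A ->
    exists K, [/\ closed K, K `<=` A & c <= I K].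
Proof.
move=> Imon Iup Idown A [C [Ccl Cdep ->]] cA.
(* [B l] keeps the branches whose first entries are bounded by [l]. It is the increasing union over
   [n] of [B (rcons l n)], so the continuity of [I] from below provides the next bound. *)
pose B l := [set x | exists s,
  (forall j, (j < size l)%N -> (s j <= nth 0%N l j)%N) /\ forall k, C k s x].
have [|l cB|m mP] := @prefix_choice (fun l => c < I (B l)).
- by rewrite (_ : B [::] = [set x | exists s, forall k, C k s x])//;
    apply/seteqP; split=> x [s] => [[_ sx]|sx]; exists s.
- apply: Iup.
    move=> n x [s [sb sx]]; exists s; split=> // j jl.
    have jl' : (j < size (rcons l n))%N by move: jl; rewrite !size_rcons.
    apply: (leq_trans (sb j jl')).
    by rewrite !nth_rcons; case: ltnP => // _; case: (j == _).
  apply: lt_le_trans cB _; apply: Imon => x [s [sb sx]].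
  exists (s (size l)) => //; exists s; split=> // j.
  rewrite size_rcons ltnS leq_eqVlt nth_rcons => /predU1P[->|jl].
    by rewrite ltnn eqxx.
  by rewrite jl; exact: sb.
pose L k := [set x | exists s, (forall j, (j < k)%N -> (s j <= m j)%N) /\
  forall i, (i <= k)%N -> C i s x].
exists (\bigcap_k L k).
(* Only finitely many prefixes of length [k] are bounded by [m], and [L k] is a union of closed sets
   indexed by them; [sf] extends a prefix by 0. *)
have Lcl k : closed (L k).
  pose M := (\max_(j < k) m j).+1.
  pose sf (f : {ffun 'I_k -> 'I_M}) j :=
    if insub j is Some i then nat_of_ord (f i) else 0%N.
  pose D := [set f : {ffun 'I_k -> 'I_M} |
    forall j, (j < k)%N -> (sf f j <= m j)%N].
  have -> : L k = \bigcup_(f in D) \bigcap_(i in [set i | (i <= k)%N]) C i (sf f).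
    apply/seteqP; split=> x.
      move=> [s [sm sx]].
      have sM (j : 'I_k) : (s j < M)%N.
        by rewrite ltnS (leq_trans (sm _ (ltn_ord j)))//; exact: leq_bigmax.
      pose f := [ffun j => Ordinal (sM j)].
      have fs j : (j < k)%N -> sf f j = s j.
        by move=> jk; rewrite /sf insubT ffunE.
      exists f; first by move=> j jk; rewrite fs// sm.
      move=> i /= ik; rewrite (Cdep i _ s); first exact: sx.
      by move=> j ji; apply: fs; exact: leq_trans ik.
    by move=> [f fD fx]; exists (sf f); split=> // i ik; exact: fx.
  by apply: closed_bigcup => [|f _]; [exact: finite_finset|]; apply: closed_bigI => i _.
split.
- by apply: closed_bigI => k _; exact: Lcl.
- move=> x Lx.
  pose P l := forall k, (size l <= k)%N -> exists s,
    [/\ forall j, (j < size l)%N -> s j = nth 0%N l j,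
        forall j, (j < k)%N -> (s j <= m j)%N &
        forall i, (i <= k)%N -> C i s x].
  have [|l Pl|s sP] := @prefix_choice P.
  + by move=> k _; have [s [? ?]] := Lx k Logic.I; exists s.
  + apply: contrapT => /forallNP nP.
    have /choice[h hP] n : exists k, (size l < k)%N /\ ~ exists s,
        [/\ forall j, (j < (size l).+1)%N -> s j = nth 0%N (rcons l n) j,
        forall j, (j < k)%N -> (s j <= m j)%N &
        forall i, (i <= k)%N -> C i s x].
      have := nP n; rewrite /P size_rcons => /existsNP[k] /not_implyP[? ?].
      by exists k.
    (* If no one-entry extension of [l] survives, the value [n] dies at depth [h n]. Only the values
       up to [m (size l)] are allowed, so all of them are dead at the common depth [K]. *)
    pose K := maxn (size l).+1 (\max_(n < (m (size l)).+1) h n).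
    have [|s [sl sm sx]] := Pl K.
      by rewrite (leq_trans (leqnSn _))// leq_maxl.
    have lK : (size l < K)%N by rewrite leq_maxl.
    have [_] := hP (s (size l)); apply.
    have hK : (h (s (size l)) <= K)%N.
      have sml : (s (size l) < (m (size l)).+1)%N by rewrite ltnS sm.
      rewrite leq_max; apply/orP; right.
      exact: (leq_bigmax (Ordinal sml)).
    exists s; split.
    * move=> j; rewrite ltnS leq_eqVlt nth_rcons => /predU1P[->|jl].
        by rewrite ltnn eqxx.
      by rewrite jl sl.
    * by move=> j jh; apply: sm; exact: leq_trans hK.
    * by move=> i ih; apply: sx; exact: leq_trans hK.
  + exists s => k; have [|t [ts _ tx]] := sP k k; first by rewrite size_mkseq.
    rewrite (Cdep k _ t); first exact: tx.
    by move=> j jk; rewrite ts ?size_mkseq// nth_mkseq.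
- apply: Idown => //.
    move=> n x [s [sm sx]]; exists s; split.
      by move=> j jn; apply: sm; exact: ltnW.
    by move=> i ni; apply: sx; exact: leqW.
  move=> k; apply: le_trans (ltW (mP k)) _; apply: Imon => x [s [sm sx]].
  exists s; split=> // j jk.
  by have := sm j; rewrite size_mkseq nth_mkseq//; apply.
Qed.

(** * Paths and hitting times *)

Lemma subset_incr (T : Type) (F : nat -> set T) :
  (forall n, F n `<=` F n.+1) -> forall m n, (m <= n)%N -> F m `<=` F n.
Proof.
move=> Finc m n /subnK <-; elim: (n - m)%N => [//|k IH]; rewrite addSn.
by apply: subset_trans IH _; exact: Finc.
Qed.

Lemma subset_decr (T : Type) (F : nat -> set T) :
  (forall n, F n.+1 `<=` F n) -> forall m n, (m <= n)%N -> F n `<=` F m.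
Proof.
move=> Fdec m n /subnK <-; elim: (n - m)%N => [//|k IH]; rewrite addSn.
exact: subset_trans (Fdec _) IH.
Qed.

Section enlargement.
Context (R : realType) (T : pseudoMetricType R).
Implicit Types (K : set T).

(** Interiors are taken because the balls of a pseudometric structure need not be open. *)
Definition enlarge K (n : nat) : set T :=
  \bigcup_(z in K) (ball z n.+1%:R^-1)^°.

Lemma open_enlarge K n : open (enlarge K n).
Proof. by apply: bigcup_open => z _; exact: open_interior. Qed.

Lemma sub_enlarge K n : K `<=` enlarge K n.
Proof.
move=> x Kx; exists x => //; apply: nbhsx_ballx.
by rewrite invr_gt0.
Qed.

(** If the ball of radius [e] around [x] misses [K], points within [e / 2] of [x] are out of reach
    of radii below [e / 2]. The joint neighbourhood in point and radius is what compactness of time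
    intervals uses later. *)
Lemma enlarge_far K x : closed K -> ~ K x ->
  \forall y \near x & n \near \oo, ~ enlarge K n y.
Proof.
move=> Kcl nKx.
have : nbhs x (~` K) by apply: open_nbhs_nbhs; split => //; exact: closed_openC.
move=> /nbhs_ballP[e /= e0 xe].
exists (ball x (e / 2), [set n | (n.+1%:R^-1 < e / 2 :> R)%R]) => /=.
  split; first by apply: nbhsx_ballx; rewrite divr_gt0.
  by apply: near_infty_natSinv_lt (PosNum _); rewrite divr_gt0.
move=> [y n] /= [xy ne] [z Kz /interior_subset zy].
apply: (xe z) => //; apply: (@ball_splitr _ _ y).
  exact: ball_sym.
by apply: ball_sym; apply: le_ball zy; exact: ltW.
Qed.

Lemma enlarge_bigcap K : closed K -> \bigcap_n enlarge K n = K.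
Proof.
move=> Kcl; apply/seteqP; split=> [x Kx|x Kx n _]; last exact: sub_enlarge.
apply: contrapT => nKx.
have [[U V] /= [Ux [N _ NV]] UV] := enlarge_far Kcl nKx.
have := UV (x, N); apply => /=; last exact: Kx.
by split; [exact: nbhs_singleton|apply: NV => /=].
Qed.

Lemma open_Fsigma (U : set T) : open U -> Fsigma U.
Proof.
move=> oU; exists (fun n => ~` enlarge (~` U) n).
  by move=> n; apply: open_closedC; exact: open_enlarge.
by rewrite -setC_bigcap enlarge_bigcap ?setCK//; exact: open_closedC.
Qed.

End enlargement.

Lemma Fsigma_bigcup (T : topologicalType) (F : nat -> set T) :
  (forall n, Fsigma (F n)) -> Fsigma (\bigcup_n F n).
Proof.
move=> FF; have /choice[G GP] i : exists G : nat -> set T,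
    (forall j, closed (G j)) /\ F i = \bigcup_j G j.
  by have [G] := FF i; exists G.
exists (fun m => if unpickle m is Some (i, j) then G i j else set0).
  move=> m; case: unpickle => [[i j]|]; last exact: closed0.
  by have [+ _] := GP i; exact.
apply/seteqP; split=> x.
  move=> [i _]; have [_ ->] := GP i; move=> [j _ Gx].
  by exists (pickle (i, j)) => //; rewrite pickleK.
move=> [m _]; case: unpickle => [[i j]|//] Gx.
by exists i => //; have [_ ->] := GP i; exists j.
Qed.

Lemma Fsigma_incr (T : topologicalType) (A : set T) : Fsigma A ->
  exists F : nat -> set T, [/\ forall n, closed (F n),
    forall n, F n `<=` F n.+1 & A = \bigcup_n F n].
Proof.
move=> [F Fcl ->]; exists (fun n => \bigcup_(i in `I_n) F i); split.
- by move=> n; apply: closed_bigcup => //; exact: finite_II.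
- by move=> n; apply: bigcup_subset => i /= /ltnW.
- apply/seteqP; split=> x; first by move=> [n _ Fx]; exists n.+1 => //; exists n => /=.
  by move=> [n _ [i _ Fx]]; exists i.
Qed.

(** The positive part maps the line continuously to the half-line. Paths and the discount function
    are both handled this way. *)
Lemma continuous_max0 (R : realType) (T : topologicalType) (g : R -> T) :
  {within `[0%R, +oo[, continuous g} ->
  continuous (fun s : R => g (Num.max s 0%R)).
Proof.
move=> /subspace_continuousP gc t.
have := gc (Num.max t 0%R); rewrite /= in_itv/= andbT le_max lexx orbT => /(_ isT).
move=> gt U /gt; rewrite !near_simpl => gU.
have /(_ _ gU) : (fun s : R => Num.max s 0%R) @ t --> Num.max t 0%R.
  by apply: continuous_max; [exact: cvg_id|exact: cvg_cst].
rewrite /= !near_simpl; apply: filterS => s /=.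
by rewrite in_itv/= andbT le_max lexx orbT => /(_ isT).
Qed.

Section paths.
Context (R : realType) (d : nat).
Local Notation E := (Rd R d).
Local Notation Omega := (path_space R d).

Lemma path_cont (w : Omega) : continuous (w : R -> 'rV[R]_d).
Proof.
rewrite (_ : (w : R -> _) = fun s => w (Num.max s 0%R)).
  exact: continuous_max0 (@path_continuous _ _ w).
by apply/funext => s; case: (leP 0%R s) => // /path_before0.
Qed.

Lemma path_nbhs (w : Omega) (t : R) (U : set 'rV[R]_d) : open U -> U (w t) ->
  nbhs t [set s | U (w s)].
Proof. by move=> oU Ut; apply: (@path_cont w t U); exact: open_nbhs_nbhs. Qed.

Lemma raw_filtration_coord (t s : R) (B : set E) : (0 <= s <= t)%R ->
  measurable B -> raw_filtration t [set w : Omega | B (w s)].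
Proof.
by move=> st mB; apply: sub_sigma_algebra; exists s; [rewrite /= in_itv|exists B].
Qed.

Lemma raw_filtration_le (s t : R) (A : set Omega) : (s <= t)%R ->
  raw_filtration s A -> raw_filtration t A.
Proof.
move=> st; apply: sub_smallest2r; first exact: smallest_sigma_algebra.
move=> _ [u /= + [B mB ->]]; rewrite in_itv/= => /andP[u0 us].
by exists u; [rewrite /= in_itv/= u0 (le_trans us)|exists B].
Qed.

Lemma raw_filtration_measurable (t : R) (A : set Omega) :
  raw_filtration t A -> measurable A.
Proof.
apply: sub_smallest2r; first exact: smallest_sigma_algebra.
move=> _ [u /= + [B mB ->]]; rewrite in_itv/= => /andP[u0 us].
by exists u; [rewrite /= in_itv/= u0|exists B].
Qed.

Lemma measurable_coord (t : R) : measurable_fun [set: Omega] (fun w => w t : E).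
Proof.
move=> _ B mB; rewrite setTI.
have [t0|t0] := leP 0%R t.
  by apply: (@raw_filtration_measurable t); apply: raw_filtration_coord; rewrite ?t0/=.
rewrite (_ : _ @^-1` _ = [set w : Omega | B (w 0%R)]).
  by apply: (@raw_filtration_measurable 0); apply: raw_filtration_coord; rewrite ?lexx.
by apply/seteqP; split=> w /=; rewrite path_before0.
Qed.

Lemma measurable_open (U : set 'rV[R]_d) : open U -> measurable (U : set E).
Proof. by move=> oU; exact: sub_sigma_algebra. Qed.

Lemma measurable_closed (K : set 'rV[R]_d) : closed K -> measurable (K : set E).
Proof.
move=> /closed_openC/measurable_open/measurableC.
by rewrite setCK.
Qed.

(** By continuity, a path is in a closed [K] at time [t] iff, for every [n], it lies in the [n]-th
    enlargement of [K] at some rational time within [1/(n+1)] of [t]. This is a countable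
    combination of measurable rectangles. *)
Lemma measurable_eval :
  measurable_fun [set: R * Omega] (fun p => p.2 p.1 : E).
Proof.
apply: (@measurability _ _ (R * Omega)%type E _ _ (@open 'rV[R]_d)) => // _ [U oU <-].
rewrite setTI.
suff {U oU} mK K : closed K -> measurable [set p : R * Omega | K (p.2 p.1 : 'rV[R]_d)].
  rewrite (_ : _ @^-1` U = ~` [set p : R * Omega | (~` U) (p.2 p.1)]).
    by apply: measurableC; apply: mK; exact: open_closedC.
  by apply/seteqP; split=> p /=; [move=> Up; exact|exact: contrapT].
move=> Kcl.
have -> : [set p : R * Omega | K (p.2 p.1 : 'rV[R]_d)] =
    \bigcap_n \bigcup_(q : rat) (ball (ratr q : R) n.+1%:R^-1 `*`
                           [set w : Omega | enlarge K n (w (ratr q))]).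
  apply/seteqP; split=> [[t w] /= Kw n _|[t w] /= tw].
    have : nbhs t [set s | enlarge K n (w s)].
      by apply: path_nbhs; [exact: open_enlarge|exact: sub_enlarge].
    have : nbhs t (ball t (n.+1%:R^-1 : R)).
      by apply: nbhsx_ballx; rewrite invr_gt0.
    move=> /filterI/[apply] /nbhs_ballP[e /= e0 te].
    have [q] : exists q : rat, ratr q \in `](t - e)%R, (t + e)%R[.
      by apply: rat_in_itvoo; rewrite ltrBlDr -addrA ltrDl addr_gt0.
    rewrite in_itv/= => qe.
    have /te[tq Kq] : ball t e (ratr q : R).
      by rewrite /ball/= distrC ltr_distl.
    by exists q => //; split => //=; exact: ball_sym.
  apply: contrapT => nK.
  have := enlarge_far Kcl nK => -[[U V] /= [/path_cont wU [N _ NV]] UV].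
  move: wU => /nbhs_ballP[e /= e0 te].
  have [M _ MP] : \forall n \near \oo, (n.+1%:R^-1 < e)%R.
    exact: near_infty_natSinv_lt (PosNum e0).
  have [q _ [/= tq Kq]] := tw (maxn M N) I.
  apply: (UV (w (ratr q), maxn M N)) => //=; split.
    apply: te; apply: ball_sym; apply: le_ball tq; apply: ltW; apply: MP => /=.
    by rewrite leq_maxl.
  by apply: NV => /=; rewrite leq_maxr.
apply: bigcapT_measurable => n; apply: bigcupT_measurable_rat => q.
apply: measurableX; first exact: measurable_ball.
rewrite -[X in measurable X]setTI; apply: measurable_coord => //.
by apply: measurable_open; exact: open_enlarge.
Qed.

(** The time interval is compact so that these events commute with decreasing intersections of
    closed sets, as a capacity demands. *)
Definition hits (a b : R) (B : set E) : set Omega :=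
  [set w | exists2 t, (a <= t <= b)%R & B (w t)].

Lemma hitsS a b B B' : B `<=` B' -> hits a b B `<=` hits a b B'.
Proof. by move=> BB' w [t tab /BB' Bt]; exists t. Qed.

Lemma hits_bigcup a b (F : nat -> set E) :
  hits a b (\bigcup_n F n) = \bigcup_n hits a b (F n).
Proof.
apply/seteqP; split=> w.
  by move=> [t tab [n _ Fn]]; exists n => //; exists t.
by move=> [n _ [t tab Fn]]; exists t => //; exists n.
Qed.

(** If no time of [[a, b]] lies in all the visits, each time has a neighbourhood on which the path
    avoids [F n] for all large [n]; compactness makes [n] uniform. *)
Lemma hits_bigcap a b (F : nat -> set 'rV[R]_d) :
  (forall n, closed (F n)) -> (forall n, F n.+1 `<=` F n) ->
  hits a b (\bigcap_n F n) = \bigcap_n hits a b (F n).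
Proof.
move=> Fcl Fdec.
have Fle := subset_decr Fdec.
apply/seteqP; split=> w; first by move=> [t tab Ft] n _; exists t => //; exact: Ft.
move=> hw; apply: contrapT => nh.
have /compact_near_coveringP := @segment_compact R a b.
move=> /(_ nat \oo (fun n s => ~ F n (w s)))[t /= tab|N _ NP].
- have [n Fn] : exists n, ~ F n (w t).
    apply: contrapT => /forallNP Fw; apply: nh; exists t.
      by move: tab; rewrite in_itv.
    by move=> n _; apply: contrapT; exact: Fw.
  have : nbhs t [set s | ~ F n (w s)].
    by apply: (@path_nbhs _ _ (~` F n)) => //; exact: closed_openC.
  move=> tU; exists ([set s | ~ F n (w s)], [set m | (n <= m)%N]) => /=.
    by split => //; exists n.
  by move=> [s m] /= [nFs nm]; apply: contra_not nFs; exact: Fle.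
- have [t tab Ft] := hw N I.
  by apply: (NP N _ t) => //=; rewrite in_itv.
Qed.

(** A visit to [K] puts the path in each open enlargement at nearby rational times of []a, b[].
    Conversely, by compactness, a path that avoids [K] on [[a, b]] avoids all small enlargements
    there. *)
Lemma hits_closedE a b (K : set 'rV[R]_d) : (a < b)%R -> closed K ->
  hits a b K = \bigcap_n \bigcup_(q : rat)
    (if (a < ratr q < b)%R then [set w : Omega | enlarge K n (w (ratr q))] else set0).
Proof.
move=> ab Kcl; apply/seteqP; split=> w.
  move=> [t /andP[ta tb] Kw] n _.
  have : nbhs t [set s | enlarge K n (w s)].
    by apply: path_nbhs; [exact: open_enlarge|exact: sub_enlarge].
  move=> /nbhs_ballP[e /= e0 te].
  have [q] : exists q : rat,
      ratr q \in `](Num.max a (t - e)), (Num.min b (t + e))[%R.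
    apply: rat_in_itvoo; rewrite gt_max !lt_min ab/=.
    apply/and3P; split.
    - by rewrite (le_lt_trans ta)// ltrDl.
    - by rewrite (lt_le_trans _ tb)// ltrBlDr ltrDl.
    - by rewrite ltrBlDr -addrA ltrDl addr_gt0.
  rewrite in_itv/= gt_max lt_min => /andP[/andP[aq teq] /andP[qb qte]].
  exists q => //; rewrite aq qb/=; apply: te.
  by rewrite /ball/= distrC ltr_distl teq.
move=> hw; apply: contrapT => nh.
have /compact_near_coveringP := @segment_compact R a b.
move=> /(_ nat \oo (fun n s => ~ enlarge K n (w s)))[t /= tab|N _ NP].
- have nK : ~ K (w t).
    by move=> Kw; apply: nh; exists t => //; move: tab; rewrite in_itv.
  have [[U V] /= [/path_cont wU Voo] UV] := enlarge_far Kcl nK.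
  exists (w @^-1` U, V) => //= -[s m] /= [Us Vm].
  exact: (UV (w s, m)).
- have [q _] := hw N I; case: ifPn => // /andP[aq qb] Kq.
  by apply: (NP N _ (ratr q)) => //=; rewrite in_itv/= !ltW.
Qed.

Lemma raw_filtration_hits a b (K : set 'rV[R]_d) : (0 <= a < b)%R -> closed K ->
  raw_filtration b (hits a b K).
Proof.
move=> /andP[a0 ab] Kcl; rewrite hits_closedE//.
pose S := g_sigma_algebraType (@cylinders R d `[0%R, b]).
apply: (@bigcapT_measurable _ S) => n; apply: (@bigcupT_measurable_rat _ S) => q.
case: ifPn => [/andP[aq qb]|_]; last exact: measurable0.
apply: raw_filtration_coord; last by apply: measurable_open; exact: open_enlarge.
by rewrite (le_trans a0) ltW.
Qed.

Lemma measurable_hits_closed a b (K : set 'rV[R]_d) : (0 <= a < b)%R ->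
  closed K -> measurable (hits a b K).
Proof.
move=> ab Kcl; exact: raw_filtration_measurable (raw_filtration_hits ab Kcl).
Qed.

Lemma measurable_hits_Fsigma a b (B : set 'rV[R]_d) : (0 <= a < b)%R ->
  Fsigma B -> measurable (hits a b B).
Proof.
move=> ab [F Fcl ->]; rewrite hits_bigcup.
by apply: bigcupT_measurable => n; exact: measurable_hits_closed.
Qed.

Lemma hitting_time_ge0 (B : set E) w : 0 <= hitting_time B w.
Proof.
by apply: le_ereal_inf_tmp => _ [t [t0 _] <-]; rewrite lee_fin ltW.
Qed.

Lemma hitting_time_le (B : set E) (w : Omega) (t : R) : (0 < t)%R -> B (w t) ->
  hitting_time B w <= t%:E.
Proof. by move=> t0 Bt; apply: ereal_inf_lbound; exists t. Qed.

Lemma hitting_time_ltP (B : set E) (w : Omega) (s : \bar R) :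
  hitting_time B w < s <-> exists t : R, [/\ (0 < t)%R, t%:E < s & B (w t)].
Proof.
split=> [/ereal_inf_lt[_ [t [t0 Bt] <-] ts]|[t [t0 ts Bt]]]; first by exists t.
exact: le_lt_trans (hitting_time_le t0 Bt) ts.
Qed.

Lemma hitting_timeS (B B' : set E) w : B `<=` B' ->
  hitting_time B' w <= hitting_time B w.
Proof.
by move=> BB'; apply: le_ereal_inf_tmp => _ [t [t0 /BB' Bt] <-]; exact: hitting_time_le.
Qed.

(** A visit at a time in []0, s[] falls in a compact interval inside []0, s[] with rational
    endpoints. *)
Lemma hitting_time_lt_hits (B : set E) (s : R) :
  [set w | hitting_time B w < s%:E] = \bigcup_(q : rat) \bigcup_(r : rat)
    (if (0 < (ratr q : R) < ratr r)%R && (ratr r < s)%R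
     then hits (ratr q) (ratr r) B else set0).
Proof.
apply/seteqP; split=> w /=.
  move=> /hitting_time_ltP[t [t0 ts Bt]].
  have [q] := rat_in_itvoo t0; rewrite in_itv/= => /andP[q0 qt].
  have [r] := rat_in_itvoo ts; rewrite in_itv/= => /andP[tr rs].
  exists q => //; exists r => //; rewrite q0 rs (lt_trans qt tr)/=.
  by exists t => //; rewrite !ltW.
move=> [q _ [r _]]; case: ifPn => // /andP[/andP[q0 qr] rs] [t /andP[qt tr] Bt].
apply/hitting_time_ltP; exists t; split=> //; first exact: lt_le_trans qt.
by rewrite lte_fin (le_lt_trans tr).
Qed.

Lemma raw_filtration_hitting_time_lt (K : set 'rV[R]_d) (s : R) : closed K ->
  raw_filtration s [set w | hitting_time K w < s%:E].
Proof.
move=> Kcl; rewrite hitting_time_lt_hits.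
pose S := g_sigma_algebraType (@cylinders R d `[0%R, s]).
apply: (@bigcupT_measurable_rat _ S) => q.
apply: (@bigcupT_measurable_rat _ S) => r.
case: ifPn => [/andP[/andP[q0 qr] rs]|_]; last exact: measurable0.
apply: (@raw_filtration_le (ratr r)); first exact: ltW.
by apply: raw_filtration_hits => //; rewrite (ltW q0).
Qed.

Lemma measurable_hitting_time (B : set 'rV[R]_d) : Fsigma B ->
  measurable_fun [set: Omega] (fun w : Omega => hitting_time (B : set E) w).
Proof.
move=> FB _; apply: (measurability _ (ErealGenInftyO.measurableE R)) => //.
move=> _ [_ [s ->] <-]; rewrite setTI.
rewrite (_ : _ @^-1` _ = [set w | hitting_time (B : set E) w < s%:E]); last first.
  by apply/seteqP; split=> w /=; rewrite in_itv.
rewrite hitting_time_lt_hits; apply: bigcupT_measurable_rat => q.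
apply: bigcupT_measurable_rat => r.
case: ifPn => // /andP[/andP[q0 qr] rs].
by apply: measurable_hits_Fsigma => //; rewrite (ltW q0).
Qed.

End paths.

(** * Capacities of hitting events *)

(** Intersecting covers of nearly minimal measure gives a minimal one. This assigns an outer measure
    to hitting events not known to be measurable. *)
Lemma measurable_hull d (T : measurableType d) (R : realType)
    (mu : {measure set T -> \bar R}) (S : set T) :
  exists G, [/\ measurable G, S `<=` G &
    forall G', measurable G' -> S `<=` G' -> mu G <= mu G'].
Proof.
pose X := [set mu G | G in [set G | measurable G /\ S `<=` G]].
have X0 : 0 <= ereal_inf X by apply: le_ereal_inf_tmp => _ [G _ <-].
have XG G' : measurable G' -> S `<=` G' -> ereal_inf X <= mu G'.
  by move=> mG SG; apply: ereal_inf_lbound; exists G'.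
have [Xy|Xy] := eqVneq (ereal_inf X) +oo.
  exists setT; split=> // G' mG SG; have := XG G' mG SG.
  by rewrite Xy leye_eq => /eqP ->; rewrite leey.
have Xfin : ereal_inf X \is a fin_num by rewrite ge0_fin_numE// ltey.
have /choice[G GP] n : exists G, [/\ measurable G, S `<=` G &
    mu G < ereal_inf X + (n.+1%:R^-1)%:E].
  have n0 : (0 < n.+1%:R^-1 :> R)%R by rewrite invr_gt0.
  by have [_ [G [mG SG] <-] GX] := lb_ereal_inf_adherent n0 Xfin; exists G.
have mG : measurable (\bigcap_n G n).
  by apply: bigcapT_measurable => n; have [] := GP n.
exists (\bigcap_n G n); split => //.
- by apply: sub_bigcap => n _; have [] := GP n.
- move=> G' mG' SG'; apply: le_trans (XG _ mG' SG').
  apply/lee_addgt0Pr => e e0.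
  have [n _ ne] : \forall n \near \oo, (n.+1%:R^-1 < e)%R.
    exact: near_infty_natSinv_lt (PosNum e0).
  have [mGn _ GnX] := GP n.
  apply: (@le_trans _ _ (mu (G n))).
    by apply: le_measure; rewrite ?inE//; exact: bigcap_inf.
  by apply: (le_trans (ltW GnX)); rewrite leeD2l// lee_fin ltW// ne/=.
Qed.

Lemma exists_measure_gt d (T : measurableType d) (R : realType)
    (mu : {measure set T -> \bar R}) (F : nat -> set T) (c : \bar R) :
  (forall n, measurable (F n)) -> (forall n, F n `<=` F n.+1) ->
  c < mu (\bigcup_n F n) -> exists n, c < mu (F n).
Proof.
move=> mF Finc cF; apply: contrapT => /forallNP nF.
have cvF : (mu \o F) @ \oo --> mu (\bigcup_n F n).
  apply: nondecreasing_cvg_mu => //; first exact: bigcupT_measurable.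
  by move=> m n mn; apply/subsetPset; exact: (subset_incr Finc).
suff : mu (\bigcup_n F n) <= c by move=> /(lt_le_trans cF); rewrite ltxx.
rewrite -(cvg_lim _ cvF)//; apply: lime_le.
  by apply/cvg_ex; eexists; exact: cvF.
by apply: nearW => n /=; rewrite leNgt; apply/negP; exact: nF.
Qed.

Section path_capacity.
Context (R : realType) (d : nat).
Local Notation E := (Rd R d).
Local Notation Omega := (path_space R d).
Variable mu : {measure set Omega -> \bar R}.
Hypothesis mufin : mu setT < +oo.

(** The capacity [I B] is the outer measure of [hits a b B]. Choquet's theorem gives closed subsets
    of [A] with capacity arbitrarily close to that of [A], and their union exhausts the event up to
    a null set. *)
Lemma hits_capacitability (a b : R) (A : set E) : (0 <= a < b)%R -> measurable A ->
  exists A' : set 'rV[R]_d, [/\ Fsigma A', A' `<=` A &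
    mu.-negligible (hits a b A `\` hits a b A')].
Proof.
move=> ab mA.
have /choice[h hP] := measurable_hull mu.
have mh S : measurable (h S) by have [] := hP S.
have hS S : S `<=` h S by have [] := hP S.
have hle S G : measurable G -> S `<=` G -> mu (h S) <= mu G.
  by have [_ _ +] := hP S; exact.
have lemu G G' : measurable G -> measurable G' -> G `<=` G' -> mu G <= mu G'.
  by move=> mG mG' GG'; apply: le_measure; rewrite ?inE.
have fin G : measurable G -> mu G \is a fin_num.
  move=> mG; rewrite ge0_fin_numE//; apply: le_lt_trans mufin.
  exact: lemu.
pose I (B : set 'rV[R]_d) := mu (h (hits a b B)).
have Imon A1 B1 : A1 `<=` B1 -> I A1 <= I B1.
  by move=> AB; apply: hle => //; apply: subset_trans (hS _); exact: hitsS.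
have Iup c (F : nat -> set 'rV[R]_d) : (forall n, F n `<=` F n.+1) ->
    c < I (\bigcup_n F n) -> exists n, c < I (F n).
  move=> Finc cF.
  (* The hulls of increasing events need not increase; intersecting the hulls of all later events
     repairs this. *)
  pose G n := \bigcap_(k in [set k | (n <= k)%N]) h (hits a b (F k)).
  have mG n : measurable (G n) by apply: bigcap_measurableType.
  have FG n : hits a b (F n) `<=` G n.
    apply: sub_bigcap => k nk; apply: subset_trans (hS _); apply: hitsS.
    exact: (subset_incr Finc).
  have [//||n cn] := @exists_measure_gt _ _ _ mu G c mG.
  - by move=> n w Gw k nk; apply: Gw => /=; exact: ltnW.
  - apply: (lt_le_trans cF); apply: hle; first exact: bigcupT_measurable.
    by rewrite hits_bigcup => w [n _ Fw]; exists n => //; exact: FG.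
  - exists n; apply: (lt_le_trans cn); apply: lemu => //.
    by apply: bigcap_inf => /=.
have Iclosed K : closed K -> I K = mu (hits a b K).
  move=> Kcl; apply/eqP; rewrite eq_le; apply/andP; split.
    by apply: hle => //; exact: measurable_hits_closed.
  by apply: lemu => //; exact: measurable_hits_closed.
have Idown c (F : nat -> set 'rV[R]_d) : (forall n, closed (F n)) ->
    (forall n, F n.+1 `<=` F n) -> (forall n, c <= I (F n)) ->
    c <= I (\bigcap_n F n).
  move=> Fcl Fdec cF.
  (* Along closed sets the events are measurable and commute with the intersection, so continuity
     from above of the finite measure [mu] applies. *)
  have Icl : closed (\bigcap_n F n) by apply: closed_bigI.
  rewrite Iclosed// hits_bigcap//.
  have mF n : measurable (hits a b (F n)) by exact: measurable_hits_closed.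
  have cvF : (mu \o (fun n => hits a b (F n))) @ \oo -->
      mu (\bigcap_n hits a b (F n)).
    apply: nonincreasing_cvg_mu => //.
    - exact: le_lt_trans (lemu _ _ (mF _) measurableT _) mufin.
    - exact: bigcapT_measurable.
    - by move=> m n mn; apply/subsetPset; apply: hitsS; exact: (subset_decr Fdec).
  rewrite -(cvg_lim _ cvF)//; apply: lime_ge.
    by apply/cvg_ex; eexists; exact: cvF.
  by apply: nearW => n /=; rewrite -Iclosed.
have sA : souslin (A : set 'rV[R]_d).
  by apply: souslin_borel => // U; exact: open_Fsigma.
have /choice[K KP] n : exists K : set 'rV[R]_d, [/\ closed K, K `<=` A &
    I A - (n.+1%:R^-1)%:E <= I K].
  apply: choquet_capacitability => //; first exact: Iup.
    exact: Idown.
  by rewrite lteBlDr// lteDl ?fin// lte_fin invr_gt0.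
exists (\bigcup_n K n); split.
- by exists K => // n; have [] := KP n.
- by apply: bigcup_sub => n _; have [] := KP n.
- have mA' : measurable (hits a b (\bigcup_n K n)).
    by apply: measurable_hits_Fsigma => //; exists K => // n; have [] := KP n.
  exists (h (hits a b A) `\` hits a b (\bigcup_n K n)); split.
  + exact: measurableD.
  + have XY : mu (h (hits a b A)) = mu (hits a b (\bigcup_n K n)).
      apply/eqP; rewrite eq_le; apply/andP; split; last first.
        apply: lemu => //; apply: subset_trans (hS _); apply: hitsS.
        by apply: bigcup_sub => n _; have [] := KP n.
      apply/lee_addgt0Pr => e e0.
      have [n _ ne] : \forall n \near \oo, (n.+1%:R^-1 < e)%R.
        exact: near_infty_natSinv_lt (PosNum e0).
      have [Kcl _ IK] := KP n.
      rewrite -leeBlDr//; apply: (@le_trans _ _ (I (K n))).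
        by apply: le_trans IK; rewrite leeB// lee_fin ltW// ne/=.
      by rewrite Iclosed//; apply: lemu => //;
        [exact: measurable_hits_closed|apply: hitsS; exact: bigcup_sup].
    rewrite measureD//; last by rewrite -ge0_fin_numE// fin.
    have -> : h (hits a b A) `&` hits a b (\bigcup_n K n) =
        hits a b (\bigcup_n K n).
      apply: setIidr; apply: subset_trans (hS _); apply: hitsS.
      by apply: bigcup_sub => n _; have [] := KP n.
    change (mu (h (hits a b A)) - mu (hits a b (\bigcup_n K n)) = 0%R).
    by rewrite XY subee// fin.
  + by apply: setSD; exact: hS.
Qed.

(** A subset is chosen for each rational time interval, and [A'] is their union. If the hitting
    times differ, some rational interval contains a visit to [A] but none to its own subset: one of
    countably many null events. *)
Lemma hitting_time_Fsigma_ae (A : set E) : measurable A ->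
  exists A' : set 'rV[R]_d, [/\ Fsigma A', A' `<=` A &
    {ae mu, forall w, hitting_time A w = hitting_time (A' : set E) w}].
Proof.
move=> mA.
have /choice[B BP] (qr : rat * rat) : exists B : set 'rV[R]_d,
    [/\ Fsigma B, B `<=` A & (0 <= (ratr qr.1 : R) < ratr qr.2)%R ->
      mu.-negligible (hits (ratr qr.1) (ratr qr.2) A `\`
                      hits (ratr qr.1) (ratr qr.2) B)].
  have [qr0|] := boolP (0 <= (ratr qr.1 : R) < ratr qr.2)%R.
    by have [B [? ? ?]] := hits_capacitability qr0 mA; exists B.
  by exists set0; split => //; apply: closed_Fsigma; exact: closed0.
pose C n := if unpickle n is Some qr then B qr else set0.
have CF n : Fsigma (C n).
  rewrite /C; case: unpickle => [qr|]; first by have [] := BP qr.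
  by apply: closed_Fsigma; exact: closed0.
have CA n : C n `<=` A.
  by rewrite /C; case: unpickle => [qr|//]; have [] := BP qr.
exists (\bigcup_n C n); split.
- exact: Fsigma_bigcup.
- exact: bigcup_sub.
- pose N n := if (unpickle n : option (rat * rat)) is Some qr then
    (if (0 <= (ratr qr.1 : R) < ratr qr.2)%R then
      hits (ratr qr.1) (ratr qr.2) A `\` hits (ratr qr.1) (ratr qr.2) (B qr)
     else set0) else set0.
  apply: (@negligibleS _ _ _ _ (\bigcup_n N n)); last first.
    apply: negligible_bigcup => n; rewrite /N.
    case: unpickle => [qr|]; last exact: negligible_set0.
    case: ifPn => [qr0|_]; last exact: negligible_set0.
    by have [_ _ +] := BP qr; exact.
  move=> w /= /eqP nAC.
  have /hitting_time_ltP[t [t0 tC At]] :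
      hitting_time A w < hitting_time (\bigcup_n C n : set E) w.
    by rewrite lt_neqAle nAC/=; apply: hitting_timeS; exact: bigcup_sub.
  have [s [ts sC]] : exists s : R, (t < s)%R /\
      s%:E <= hitting_time (\bigcup_n C n : set E) w.
    move: tC; case: hitting_time => [r|_|//]; first by rewrite lte_fin; exists r.
    by exists (t + 1)%R; rewrite ltrDl ltr01 leey.
  have [q] := rat_in_itvoo t0; rewrite in_itv/= => /andP[q0 qt].
  have [r] := rat_in_itvoo ts; rewrite in_itv/= => /andP[tr rs].
  have [m mK] : exists m, unpickle m = Some (q, r).
    by exists (pickle (q, r)); exact: pickleK.
  exists m => //; rewrite /N mK/= (ltW q0) (lt_trans qt tr)/=.
  split; first by exists t => //; rewrite !ltW.
  move=> [u /andP[qu ur] Bu].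
  have : hitting_time (\bigcup_n C n : set E) w <= u%:E.
    apply: hitting_time_le; first exact: lt_le_trans qu.
    by exists m => //; rewrite /C mK.
  move=> /(le_trans sC); rewrite lee_fin leNgt => /negP; apply.
  exact: le_lt_trans rs.
Qed.

End path_capacity.

(** * The Markov property of the path laws *)

Lemma completed_measure_extensionE d (T : measurableType d) (R : realType)
    (mu : {measure set T -> \bar R}) (A : set T) :
  measurable A -> @completed_measure_extension _ _ _ mu A = mu A.
Proof. exact: measurable_mu_extE. Qed.

(** The identity is measurable from the completed sigma-algebra to the original one and pushes the
    completion forward to [mu]. *)
Lemma ge0_integral_completed d (T : measurableType d) (R : realType)
    (mu : {measure set T -> \bar R}) (D : set T) (f : T -> \bar R) :
  measurable D -> measurable_fun setT f -> (forall x, 0 <= f x) ->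
  \int[@completed_measure_extension _ _ _ mu]_(x in D) f x = \int[mu]_(x in D) f x.
Proof.
move=> mD mf f0.
have mid : measurable_fun setT (id : caratheodory_type (mu^*)%mu -> T).
  by move=> _ B mB; rewrite setTI; exact: caratheodory_measurable_mu_ext.
transitivity (\int[pushforward (@completed_measure_extension _ _ _ mu)
    (id : caratheodory_type (mu^*)%mu -> T)]_(x in D) f x).
  by rewrite ge0_integral_pushforward//; exact: measurable_funTS.
apply: eq_measure_integral => A mA _.
exact: completed_measure_extensionE.
Qed.

Section mixture.
Context d d' (X : measurableType d) (Y : measurableType d') (R : realType).
Variables (mu : {measure set X -> \bar R}) (D : set X).
Hypothesis mD : measurable D.
Import HBNNSimple.

Let mixture_nnsfun (k : X -> {measure set Y -> \bar R})
  (mk : forall U, measurable U -> measurable_fun setT (fun x => k x U))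
  (f : {nnsfun Y >-> R}) :
  \int[mu]_(x in D) \int[k x]_y (f y)%:E =
  \sum_(r \in range f) (r%:E * \int[mu]_(x in D) k x (f @^-1` [set r])).
Proof.
have mfr r : measurable (f @^-1` [set r]) by exact: measurable_sfunP.
under eq_integral.
  move=> x _.
  under eq_integral.
    by move=> z _; rewrite fimfunE -fsumEFin//; over.
  rewrite /= ge0_integral_fsum//; last 2 first.
    - by move=> r; exact/measurable_EFinP/measurableT_comp.
    - by move=> r z _; rewrite EFinM nnfun_muleindic_ge0.
  under eq_fsbigr.
    move=> r _.
    rewrite (integralZl_indic _ (fun r => f @^-1` [set r]))//; last first.
      by move=> r0; rewrite preimage_nnfun0.
    rewrite integral_indic// setIT.
    over.
  over.
rewrite /= ge0_integral_fsum//; last 2 first.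
  - move=> r; apply: measurable_funeM; apply: measurable_funTS; exact: mk.
  - move=> n y _.
    have := mulemu_ge0 (fun n => f @^-1` [set n]).
    by apply; exact: preimage_nnfun0.
apply: eq_fsbigr => r _.
(* A negative [r] is not a value of [f], so both sides vanish; a nonnegative one can leave the
   integral. *)
have [r0|r0] := leP 0%R r.
  by rewrite ge0_integralZl//; apply: measurable_funTS; exact: mk.
rewrite integral0_eq.
  by rewrite integral0_eq ?mule0// => y _; rewrite preimage_nnfun0// measure0.
by move=> y _; rewrite preimage_nnfun0// measure0 mule0.
Qed.

(** Equality on sets passes to simple functions, then to nonnegative ones by monotone
    convergence. *)
Lemma eq_integral_mixture (k1 k2 : X -> {measure set Y -> \bar R}) :
  (forall U, measurable U -> measurable_fun setT (fun x => k1 x U)) ->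
  (forall U, measurable U -> measurable_fun setT (fun x => k2 x U)) ->
  (forall U, measurable U ->
     \int[mu]_(x in D) k1 x U = \int[mu]_(x in D) k2 x U) ->
  forall f : Y -> \bar R, measurable_fun setT f -> (forall y, 0 <= f y) ->
  \int[mu]_(x in D) \int[k1 x]_y f y = \int[mu]_(x in D) \int[k2 x]_y f y.
Proof.
move=> mk1 mk2 k12 f mf f0.
pose f_ := nnsfun_approx measurableT mf.
have mixE (k : X -> {measure set Y -> \bar R}) :
    (forall U, measurable U -> measurable_fun setT (fun x => k x U)) ->
    \int[mu]_(x in D) \int[k x]_y f y =
    limn (fun n => \int[mu]_(x in D) \int[k x]_y (f_ n y)%:E).
  move=> mk.
  transitivity (\int[mu]_(x in D) lim ((\int[k x]_z (f_ n z)%:E) @[n --> \oo])).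
    apply: eq_integral => y _; rewrite -monotone_convergence//; last 3 first.
    - by move=> n; exact/measurable_EFinP.
    - by move=> n z _; rewrite lee_fin.
    - by move=> z _ a b ab; rewrite lee_fin; exact/lefP/nd_nnsfun_approx.
    apply: eq_integral => z _; apply/esym/cvg_lim => //; exact: cvg_nnsfun_approx.
  rewrite monotone_convergence//.
  - move=> n; apply: measurable_funTS; apply: measurable_fun_integral_kernel => //.
    + by move=> z; rewrite lee_fin.
    + exact/measurable_EFinP.
  - by move=> n y _; apply: integral_ge0 => // z _; rewrite lee_fin.
  - move=> y _ a b ab; apply: ge0_le_integral => //.
    + by move=> z _; rewrite lee_fin.
    + exact/measurable_EFinP.
    + exact/measurable_EFinP.
    + by move=> z _; rewrite lee_fin; exact/lefP/nd_nnsfun_approx.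
rewrite (mixE k1 mk1) (mixE k2 mk2); congr (limn _); apply/funext => n.
rewrite !mixture_nnsfun//; apply: eq_fsbigr => r _.
by rewrite k12//; exact: measurable_sfunP.
Qed.

(** The case of Dirac kernels at [phi x]. It turns a Markov property for events into one for
    functions. *)
Lemma integral_comp_mixture (phi : X -> Y) (k : X -> {measure set Y -> \bar R}) :
  measurable_fun setT phi ->
  (forall U, measurable U -> measurable_fun setT (fun x => k x U)) ->
  (forall U, measurable U ->
     mu (D `&` phi @^-1` U) = \int[mu]_(x in D) k x U) ->
  forall f : Y -> \bar R, measurable_fun setT f -> (forall y, 0 <= f y) ->
  \int[mu]_(x in D) f (phi x) = \int[mu]_(x in D) \int[k x]_y f y.
Proof.
move=> mphi mk phik f mf f0.
have mphiU U : measurable U -> measurable (phi @^-1` U).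
  by move=> mU; rewrite -[X in measurable X]setTI; exact: mphi.
rewrite -(@eq_integral_mixture (fun x => \d_(phi x)))//.
- apply: eq_integral => x _; rewrite integral_dirac//.
  by rewrite diracT mul1e.
- move=> U mU; apply/measurable_EFinP.
  rewrite (_ : (fun x => _) = \1_(phi @^-1` U)); last first.
    by apply/funext => x; rewrite !indicE; congr (_%:R);
      apply/idP/idP => /set_mem ?; exact/mem_set.
  exact: measurable_indic (mphiU _ mU).
- move=> U mU; rewrite -phik// setIC -integral_indic//; last exact: mphiU.
Qed.

End mixture.

Section shift.
Context (R : realType) (d : nat).
Local Notation E := (Rd R d).
Local Notation Omega := (path_space R d).

(** The maximum freezes the shifted path before time 0, as [path_space] requires. *)
Definition shift_fun (t : R) (w : Omega) (s : R) : 'rV[R]_d := w (t + Num.max s 0)%R.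

Fact shift_fun_continuous t w : {within `[0%R, +oo[, continuous (shift_fun t w)}.
Proof.
apply: continuous_subspaceT => s.
have cmax : {for s, continuous (fun s : R => t + Num.max s 0)%R}.
  apply: continuousD; first exact: cvg_cst.
  by apply: continuous_max; [exact: cvg_id|exact: cvg_cst].
exact: (continuous_comp cmax (@path_cont _ _ w _)).
Qed.

Fact shift_fun_before0 t w (s : R) : (s < 0)%R -> shift_fun t w s = shift_fun t w 0%R.
Proof. by move=> s0; rewrite /shift_fun maxxx max_r// ltW. Qed.

Definition shift_path (t : R) (w : Omega) : Omega :=
  Path (@shift_fun_continuous t w) (@shift_fun_before0 t w).

Lemma shift_pathE t w s : (0 <= s)%R -> shift_path t w s = w (t + s)%R.
Proof. by move=> s0; rewrite /shift_path/= /shift_fun max_l. Qed.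

Lemma measurable_shift_path t : measurable_fun [set: Omega] (shift_path t).
Proof.
apply: (@measurability _ _ Omega Omega _ _ (@cylinders R d `[0%R, +oo[)) => //.
move=> _ [_ [s /= + [B mB ->]] <-]; rewrite in_itv/= andbT => s0.
rewrite setTI (_ : _ @^-1` _ = (fun w : Omega => w (t + s)%R : E) @^-1` B).
  by rewrite -[X in measurable X]setTI; exact: measurable_coord.
by apply/seteqP; split=> w; rewrite /preimage/= /shift_fun max_l.
Qed.

End shift.

Section kernel_law.
Context d d' (X : measurableType d) (Y : measurableType d') (R : realType).
Variables (k : R.-pker X ~> Y) (x : X).

(** A separate name lets [k x] carry the structure of a probability, as initial laws and Tonelli's
    theorem expect. *)
Definition kernel_law : set Y -> \bar R := k x.

HB.instance Definition _ := Measure.copy kernel_law (k x).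

HB.instance Definition _ :=
  Measure_isProbability.Build _ _ _ kernel_law (prob_kernel x).

End kernel_law.

Section markov.
Context (R : realType) (d : nat) (P : R.-pker (Rd R d) ~> (path_space R d)).
Local Notation E := (Rd R d).
Local Notation Omega := (path_space R d).

Lemma raw_filtrationT (t : R) : raw_filtration t [set: Omega].
Proof.
pose S := g_sigma_algebraType (@cylinders R d `[0%R, t]).
rewrite -setC0; apply: (@measurableC _ S).
exact: measurable0.
Qed.

Lemma raw_filtration_sub_filtration (t : R) (C : set Omega) :
  raw_filtration t C -> filtration P t C.
Proof.
by move=> rC mu; apply: sub_sigma_algebra; left.
Qed.

Lemma raw_filtration_right (t : R) (C : set Omega) :
  (forall s, (t < s)%R -> raw_filtration s C) -> filtration_right P t C.
Proof.
move=> rC s /=; rewrite in_itv/= andbT => ts.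
exact: raw_filtration_sub_filtration (rC s ts).
Qed.

Lemma stopping_time_cst (u : R) : (0 <= u)%R ->
  stopping_time P (fun _ : Omega => u%:E).
Proof.
move=> u0; split=> [w|t t0]; first by rewrite lee_fin.
apply: raw_filtration_right => s ts.
have [ut|tu] := leP u t.
  rewrite (_ : [set _ | _] = setT); first exact: raw_filtrationT.
  by apply/seteqP; split=> // w _ /=; rewrite lee_fin.
rewrite (_ : [set _ | _] = set0); first exact: sigma_algebra0.
by apply/seteqP; split=> // w /=; rewrite lee_fin leNgt tu.
Qed.

Lemma stopped_events_cst (u : R) (C : set Omega) : raw_filtration u C ->
  stopped_events P (fun _ : Omega => u%:E) C.
Proof.
move=> rC; split.
  by move=> mu; apply: sub_sigma_algebra; left; exact: raw_filtration_measurable rC.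
move=> t t0; apply: raw_filtration_right => s ts.
have [ut|tu] := leP u t.
  rewrite (_ : _ `&` _ = C).
    by apply: raw_filtration_le rC; rewrite (le_trans ut)// ltW.
  by apply/seteqP; split=> w => [[]//|Cw]; split=> //=; rewrite lee_fin.
rewrite (_ : _ `&` _ = set0); first exact: sigma_algebra0.
by apply/seteqP; split=> // w [_ /=]; rewrite lee_fin leNgt tu.
Qed.

Lemma stopped_eventsT (tau : Omega -> \bar R) : stopping_time P tau ->
  stopped_events P tau setT.
Proof.
move=> [_ st]; split.
  by move=> mu; apply: sub_sigma_algebra; left; exact: measurableT.
by move=> t t0; rewrite setTI; exact: st.
Qed.

Lemma stopping_time_closed (K : set 'rV[R]_d) : closed K ->
  stopping_time P (fun w => hitting_time (K : set E) w).
Proof.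
move=> Kcl; split=> [w|t t0]; first exact: hitting_time_ge0.
apply: raw_filtration_right => s ts.
pose S := g_sigma_algebraType (@cylinders R d `[0%R, s]).
(* The minimum with [s] keeps each event in the raw sigma-algebra at the given time [s > t]. *)
rewrite (_ : [set _ | _] = \bigcap_n
    [set w | hitting_time (K : set E) w < (Num.min s (t + n.+1%:R^-1))%:E]).
  apply: (@bigcapT_measurable _ S) => n.
  apply: (@raw_filtration_le _ _ (Num.min s (t + n.+1%:R^-1))%R).
    by rewrite ge_min lexx.
  exact: raw_filtration_hitting_time_lt.
apply/seteqP; split=> w /=.
  move=> Kt n _ /=; apply: le_lt_trans Kt _.
  by rewrite lte_fin lt_min ts/= ltrDl invr_gt0.
move=> Kw; apply/lee_addgt0Pr => e e0.
have [n _ ne] : \forall n \near \oo, (n.+1%:R^-1 < e)%R.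
  exact: near_infty_natSinv_lt (PosNum e0).
apply: (le_trans (ltW (Kw n I))); rewrite -EFinD lee_fin ge_min.
by apply/orP; right; rewrite lerD2l ltW// ne/=.
Qed.

Variable Pt : R -> R.-pker E ~> E.
Hypothesis SM : strong_markov_process P Pt.

Let P_start (x : E) : {ae P x, forall w : Omega, w 0%R = x}.
Proof. by have [_ + _] := SM; apply. Qed.

Lemma measurable_transition_coord (t u : R) (B : set E) : measurable B ->
  measurable_fun [set: Omega] (fun w => Pt t (w u) B).
Proof.
move=> mB; apply: (measurableT_comp (measurable_kernel (Pt t) B mB)).
exact: measurable_coord.
Qed.

(** The strong Markov property at a constant time; the events are measurable, so the completed law
    reduces to [P x]. *)
Lemma simple_markov (x : E) (u t : R) (C : set Omega) (B : set E) :
  (0 <= u)%R -> (0 <= t)%R -> raw_filtration u C -> measurable B ->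
  P x (C `&` [set w : Omega | B (w (u + t)%R)]) = \int[P x]_(w in C) Pt t (w u) B.
Proof.
move=> u0 t0 rC mB; have [_ _ sm] := SM.
have := sm x _ C t B (stopping_time_cst u0) (stopped_events_cst rC) t0 mB.
rewrite (_ : C `&` [set _ | _ < _] = C); last first.
  by apply/seteqP; split=> w => [[]//|Cw]; split=> //=; rewrite ltry.
have mC := raw_filtration_measurable rC.
rewrite completed_measure_extensionE/=; last first.
  apply: measurableI => //; rewrite -[X in measurable X]setTI.
  exact: (@measurable_coord R d (u + t)%R measurableT B mB).
move=> ->; rewrite ge0_integral_completed//.
exact: measurable_transition_coord.
Qed.

Lemma path_law_coord (x : E) (t : R) (B : set E) : (0 <= t)%R -> measurable B ->
  P x [set w : Omega | B (w t)] = Pt t x B.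
Proof.
move=> t0 mB.
have := simple_markov x (lexx 0%R) t0 (@raw_filtrationT 0%R) mB.
rewrite setTI add0r => ->.
rewrite (@ge0_ae_eq_integral _ _ _ _ _ _ (cst (Pt t x B)))//.
- by rewrite integral_cst// -[X in _ * X]/(P x setT) prob_kernel mule1.
- exact: measurable_transition_coord.
- by apply: filterS (P_start x) => w /= ->.
Qed.

Lemma simple_markov_fun (x : E) (u t : R) (C : set Omega) (g : E -> \bar R) :
  (0 <= u)%R -> (0 <= t)%R -> raw_filtration u C ->
  measurable_fun setT g -> (forall y, 0 <= g y) ->
  \int[P x]_(w in C) g (w (u + t)%R) = \int[P x]_(w in C) \int[Pt t (w u)]_z g z.
Proof.
move=> u0 t0 rC mg g0; have mC := raw_filtration_measurable rC.
apply: (@integral_comp_mixture _ _ Omega E _ _ _ _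
  (fun w => w (u + t)%R) (fun w => Pt t (w u))) => //.
- exact: measurable_coord.
- by move=> U mU; exact: measurable_transition_coord.
- by move=> U mU; rewrite -simple_markov.
Qed.

Lemma integral_transition (y : E) (t : R) (g : E -> \bar R) : (0 <= t)%R ->
  measurable_fun setT g -> (forall y, 0 <= g y) ->
  \int[Pt t y]_z g z = \int[P y]_w g (w t).
Proof.
move=> t0 mg g0.
rewrite (eq_measure_integral (pushforward (P y) (fun w : Omega => w t : E))).
- exact: measurable_coord.
- by move=> mw; rewrite ge0_integral_pushforward.
- by move=> mw A mA _; rewrite -path_law_coord.
Qed.

(* [(h, B)] records a time increment, not a time. *)
Fixpoint cyl (t : R) (l : seq (R * set E)) : set Omega :=
  if l is p :: l' then [set w : Omega | p.2 (w (t + p.1)%R)] `&` cyl (t + p.1) l'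
  else setT.

Definition good_cyl (l : seq (R * set E)) : Prop :=
  forall p, p \in l -> (0 <= p.1)%R /\ measurable p.2.

Lemma good_cyl_cons p l : good_cyl (p :: l) ->
  [/\ (0 <= p.1)%R, measurable p.2 & good_cyl l].
Proof.
move=> gpl; have [p0 mp] := gpl p (mem_head _ _); split=> // q ql.
by apply: gpl; rewrite inE ql orbT.
Qed.

Lemma measurable_cyl t l : good_cyl l -> measurable (cyl t l).
Proof.
elim: l t => [|p l IH] t gl /=; first exact: measurableT.
have [p0 mp gl'] := good_cyl_cons gl.
apply: measurableI; last exact: IH.
rewrite -[X in measurable X]setTI.
exact: (@measurable_coord R d (t + p.1)%R measurableT _ mp).
Qed.

(** Induction on the constraints: the first one joins the past, the induction hypothesis treats the
    others from time [t + p.1], and the simple Markov property brings the result back to time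
    [t]. *)
Lemma markov_cyl (x : E) (t : R) (C : set Omega) l :
  (0 <= t)%R -> raw_filtration t C -> good_cyl l ->
  P x (C `&` cyl t l) = \int[P x]_(w in C) P (w t) (cyl 0 l).
Proof.
elim: l x t C => [|p l IH] x t C t0 rC gl.
  rewrite /= setIT; under eq_integral do rewrite prob_kernel.
  by rewrite integral_cst ?mul1e//; exact: raw_filtration_measurable rC.
have [p0 mp gl'] := good_cyl_cons gl.
have mC := raw_filtration_measurable rC.
have mcyl : measurable (cyl 0 l) by exact: measurable_cyl.
pose g (z : E) : \bar R := ((fun z => P z (cyl 0 l)) \_ p.2) z.
have g0 z : 0 <= g z by rewrite /g patchE; case: ifPn.
have mg : measurable_fun setT g.
  have : measurable_fun setT ((fun z => P z (cyl 0 l)) \_ p.2).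
    apply: (measurable_restrictT _ mp).1; apply: measurable_funTS.
    exact: measurable_kernel.
  by [].
(* Used at [x] and time [t], then at the point [w t] and time 0 to recognize the integrand. *)
have step y s D : (0 <= s)%R -> raw_filtration s D ->
    P y (D `&` cyl s (p :: l)) = \int[P y]_(w in D) g (w (s + p.1)%R).
  move=> s0 rD; rewrite /= setIA IH//.
  - by rewrite integral_mkcondr.
  - by rewrite addr_ge0.
  - apply: (@measurableI _ (g_sigma_algebraType (@cylinders R d `[0%R, (s + p.1)%R]))).
      by apply: raw_filtration_le rD; rewrite lerDl.
    by apply: raw_filtration_coord; rewrite // lexx addr_ge0.
rewrite step// simple_markov_fun//; apply: eq_integral => w _.
rewrite integral_transition// -[cyl 0 _]setTI step//; last exact: raw_filtrationT.
by rewrite add0r.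
Qed.

Lemma cyl_of_times (t : R) (l : seq (R * set E)) :
  (forall p, p \in l -> measurable p.2) -> path <=%R t [seq p.1 | p <- l] ->
  exists l', good_cyl l' /\
    cyl t l' = [set w : Omega | forall p, p \in l -> p.2 (w p.1)].
Proof.
elim: l t => [|p l IH] t ml /=.
  by exists [::]; split=> //; apply/seteqP; split.
move=> /andP[tp pl].
have [q ql|l' [gl' cl']] := IH p.1 _ pl; first by apply: ml; rewrite inE ql orbT.
exists ((p.1 - t, p.2)%R :: l'); split.
  move=> q; rewrite inE => /predU1P[->|/gl'//]; split; first by rewrite subr_ge0.
  by apply: (ml p); exact: mem_head.
rewrite /= addrC subrK cl'; apply/seteqP; split=> w /=.
  by move=> [wp wl] q; rewrite inE => /predU1P[->//|/wl].
move=> wl; split; first by apply: wl; exact: mem_head.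
by move=> q ql; apply: wl; rewrite inE ql orbT.
Qed.

(** Absolute times in any order make the class stable under intersection, by concatenation of
    lists. *)
Definition time_cylinders : set_system Omega :=
  [set G | exists2 l : seq (R * set E),
     forall p, p \in l -> (0 <= p.1)%R /\ measurable p.2 &
     G = [set w : Omega | forall p, p \in l -> p.2 (w p.1)]].

Lemma time_cylinders_cyl G : time_cylinders G ->
  exists2 l, good_cyl l & G = cyl 0 l.
Proof.
move=> [l gl ->].
pose s := sort (relpre (@fst R (set E)) <=%R) l.
have sl : s =i l by move=> p; rewrite mem_sort.
have [| |l' [gl' cl']] := @cyl_of_times 0%R s.
- by move=> p; rewrite sl => /gl[].
- rewrite path_sortedE; last exact: le_trans.
  rewrite sorted_map sort_sorted ?andbT; last by move=> p q; exact: le_total.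
  by apply/allP => _ /mapP[p + ->]; rewrite sl => /gl[].
exists l' => //; rewrite cl'; apply/seteqP.
by split=> w /= wl p; [rewrite sl|rewrite -sl]; exact: wl.
Qed.

Lemma setI_closed_time_cylinders : setI_closed time_cylinders.
Proof.
move=> _ _ [l1 g1 ->] [l2 g2 ->]; exists (l1 ++ l2).
  by move=> p; rewrite mem_cat => /orP[/g1|/g2].
apply/seteqP; split=> w /=.
  by move=> [w1 w2] p; rewrite mem_cat => /orP[/w1|/w2].
by move=> wl; split=> p pl; apply: wl; rewrite mem_cat pl ?orbT.
Qed.

Lemma time_cylindersE : @measurable _ Omega = <<s time_cylinders >>.
Proof.
apply/seteqP; split.
  apply: sub_smallest2r; first exact: smallest_sigma_algebra.
  move=> _ [t /= + [B mB ->]]; rewrite in_itv/= andbT => t0.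
  exists [:: (t, B)].
    by move=> p; rewrite inE => /eqP ->.
  apply/seteqP; split=> w /= Bt; first by move=> p; rewrite inE => /eqP ->.
  by have := Bt (t, B); apply; rewrite inE.
apply: smallest_sub; first exact: sigma_algebra_measurable.
by move=> _ /time_cylinders_cyl[l gl ->]; exact: measurable_cyl.
Qed.

(** Both sides are finite measures in [G], and [markov_cyl] equates them on the generating pi-system
    of time cylinders: the shift only moves the starting time of a [cyl]. *)
Theorem markov_property (x : E) (t : R) (G : set Omega) : (0 <= t)%R ->
  measurable G -> P x (shift_path t @^-1` G) = \int[Pt t x]_y P y G.
Proof.
move=> t0 mG.
have ms := @measurable_shift_path R d t.
rewrite -[RHS]/(law P (kernel_law (Pt t) x) G).
rewrite -[LHS]/(pushforward (P x) (shift_path t) G).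
apply: (@measure_unique _ _ Omega time_cylinders (fun=> setT)) => //.
- exact: time_cylindersE.
- exact: setI_closed_time_cylinders.
- by move=> _; exists [::] => //; apply/seteqP; split.
- by rewrite bigcup_const.
- move=> _ /time_cylinders_cyl[l gl ->].
  rewrite /law -[RHS]/(\int[Pt t x]_y P y (cyl 0 l)) integral_transition//; last first.
    by apply: measurable_kernel; exact: measurable_cyl.
  rewrite -[RHS]markov_cyl//; last exact: raw_filtrationT.
  rewrite setTI /pushforward; congr (P x _).
  have : forall p, p \in l -> (0 <= p.1)%R by move=> p /gl[].
  suff: forall u, (0 <= u)%R -> (forall p, p \in l -> (0 <= p.1)%R) ->
      shift_path t @^-1` cyl u l = cyl (t + u)%R l.
    by move=> /(_ 0%R (lexx _)); rewrite addr0.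
  elim: l {gl} => [|p l IH] u u0 l0 //=.
  have p0 : (0 <= p.1)%R by apply: l0; exact: mem_head.
  rewrite preimage_setI IH ?addr_ge0//; last first.
    by move=> q ql; apply: l0; rewrite inE ql orbT.
  rewrite addrA; congr (_ `&` _); apply/seteqP; split=> w /=;
    by rewrite /shift_fun max_l ?addr_ge0// addrA.
- by move=> _; rewrite -[X in X < _]/(P x setT) prob_kernel ltry.
Qed.

End markov.

(** * Reference measures *)

(** Normalization returns [P] by default when the total mass is 0 or infinite. In the first case
    [mu N] is 0 anyway; finiteness excludes the second. *)
Lemma mnormalize_eq0 d (T : measurableType d) (R : realType)
    (mu : {finite_measure set T -> \bar R}) (P : probability T R) (N : set T) :
  measurable N -> mnormalize mu P N = 0 -> mu N = 0.
Proof.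
move=> mN; rewrite /mnormalize.
have muN : mu N <= mu setT by apply: le_measure; rewrite ?inE.
have muT : mu setT \is a fin_num by exact: fin_num_measure.
case: ifPn => [/orP[/eqP T0 _|/eqP Ty]|].
- by apply/eqP; rewrite eq_le measure_ge0 andbT -T0.
- by rewrite Ty in muT.
rewrite negb_or => /andP[T0 _] /eqP; rewrite mule_eq0 => /orP[/eqP//|].
by rewrite eqe invr_eq0 fine_eq0// (negbTE T0).
Qed.

Section shifted_hitting_time.
Context (R : realType) (d : nat).
Local Notation E := (Rd R d).
Local Notation Omega := (path_space R d).

Lemma hitting_time_shift_le (B : set E) (w : Omega) (t : R) : (0 <= t)%R ->
  hitting_time B w <= t%:E + hitting_time B (shift_path t w).
Proof.
move=> t0; rewrite -leeBlDl//; apply: le_ereal_inf_tmp => _ [v [v0 Bv] <-].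
rewrite leeBlDl// -EFinD; apply: hitting_time_le.
  by rewrite ltr_wpDl.
by rewrite -shift_pathE// ltW.
Qed.

Lemma shift_hitting_time_le (B : set E) (w : Omega) (t u : R) :
  (0 <= t)%R -> (t < u)%R -> B (w u) ->
  hitting_time B (shift_path t w) <= (u - t)%:E.
Proof.
move=> t0 tu Bu; apply: hitting_time_le; first by rewrite subr_gt0.
by rewrite shift_pathE ?subr_ge0 1?ltW// addrC subrK.
Qed.

(** Only positive times count, so a visit to [A] at time [u] survives a shift by some [t < u] after
    which the two hitting times agree. *)
Lemma eq_hitting_time_shift (A B : set E) (w : Omega) : B `<=` A ->
  (forall e : R, (0 < e)%R -> exists t, [/\ (0 <= t)%R, (t < e)%R &
     hitting_time A (shift_path t w) = hitting_time B (shift_path t w)]) ->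
  hitting_time A w = hitting_time B w.
Proof.
move=> BA AB; apply/eqP; rewrite eq_le hitting_timeS//=.
apply: le_ereal_inf_tmp => _ [u [u0 Au] <-].
have [t [t0 tu ABt]] := AB u u0.
apply: le_trans (hitting_time_shift_le _ _ t0) _; rewrite -ABt.
apply: (@le_trans _ _ (t%:E + (u - t)%:E)).
  by rewrite leeD2l//; exact: shift_hitting_time_le.
by rewrite -EFinD addrC subrK.
Qed.

(** There are visits at or arbitrarily soon after the infimum, whereas a path outside the closed set
    stays outside for a while. *)
Lemma closed_hitting_time (K : set 'rV[R]_d) (w : Omega) : closed K ->
  hitting_time (K : set E) w < +oo -> K (w (fine (hitting_time (K : set E) w))).
Proof.
move=> Kcl Koo; set r := fine _.
have rE : hitting_time (K : set E) w = r%:E.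
  by rewrite fineK// ge0_fin_numE// hitting_time_ge0.
apply: contrapT => nK.
have : nbhs r [set s | (~` K) (w s)] by apply: path_nbhs => //; exact: closed_openC.
move=> /nbhs_ballP[e /= e0 re].
have : hitting_time (K : set E) w < (r + e)%:E by rewrite rE lte_fin ltrDl.
move=> /hitting_time_ltP[t [t0]]; rewrite lte_fin => tre Kt.
apply: (re t) => //=; rewrite /ball/= distrC ger0_norm ?ltrBlDl//.
by rewrite subr_ge0 -lee_fin -rE; exact: hitting_time_le.
Qed.

End shifted_hitting_time.

Section reference.
Context (R : realType) (d : nat) (P : R.-pker (Rd R d) ~> (path_space R d)).
Local Notation E := (Rd R d).
Local Notation Omega := (path_space R d).
Variable Pt : R -> R.-pker E ~> E.
Hypothesis SM : strong_markov_process P Pt.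
Variable lambda : {sfinite_measure set E -> \bar R}.
Hypothesis lambda_ref : reference_measure Pt lambda.

(** By [measurable_eval], [Pt t x N] is the [P x]-measure of the section at [t] of a measurable
    set. *)
Lemma measurable_transition_time (x : E) (N : set E) : measurable N ->
  measurable_fun (`[0%R, +oo[ : set R) (fun t : R => Pt t x N).
Proof.
move=> mN.
pose S := (fun p : R * Omega => p.2 p.1 : E) @^-1` N.
have mS : measurable S by rewrite -[S]setTI; exact: measurable_eval.
apply: (eq_measurable_fun (fun t => kernel_law P x (xsection S t))).
  move=> t; rewrite inE/= in_itv/= andbT => t0.
  rewrite -(path_law_coord SM)// /kernel_law; congr (P x _).
  by apply/seteqP; split=> w; rewrite /xsection /S/= inE.
apply: measurable_funTS; exact: (measurable_fun_xsection (kernel_law P x) mS).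
Qed.

(** [N] has zero potential, so [Pt t x] charges it only for [t] in a Lebesgue-null set, which cannot
    contain []0, e[]. *)
Lemma null_transition_near0 (x : E) (N : set E) (e : R) : measurable N ->
  lambda N = 0 -> (0 < e)%R ->
  exists t : R, [/\ (0 <= t)%R, (t < e)%R & Pt t x N = 0].
Proof.
move=> mN N0 e0; have [_ /(_ x) zp] := (lambda_ref mN).2 N0.
have mP := measurable_transition_time x mN.
have : ae_eq (@lebesgue_measure R) (`[0%R, +oo[%classic : set R)
    (fun t => Pt t x N) (cst 0).
  apply: (@ae_eq_integral_abs _ (measurableTypeR R) R (@lebesgue_measure R)
    (`[0%R, +oo[%classic : set R) (measurable_itv _) _ mP).1; rewrite -[RHS]zp.
  by apply: eq_integral => t _; rewrite gee0_abs.
move=> [M [mM M0 subM]].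
apply: contrapT => nt.
have eM : `]0%R, e[ `<=` M.
  move=> t /=; rewrite in_itv/= => /andP[t0 te]; apply: subM => /= /(_ _) tN.
  apply: nt; exists t; split => //; first exact: ltW.
  by apply: tN; rewrite in_itv/= ltW.
have : (@lebesgue_measure R) `]0%R, e[ <= lebesgue_measure M.
  by apply: le_measure; rewrite ?inE//; exact: measurable_itv.
rewrite M0 lebesgue_measure_itv/= lte_fin e0 sube0 lee_fin.
by move=> /(lt_le_trans e0); rewrite ltxx.
Qed.

(* An F_sigma subset that works for an initial law equivalent to [lambda] works
   after an arbitrarily small time whatever the starting point is, hence it
   works for every starting point. *)
Theorem hitting_time_Fsigma (A : set E) : measurable A ->
  exists A' : set 'rV[R]_d, [/\ Fsigma A', A' `<=` A & forall x,
    {ae P x, forall w, hitting_time A w = hitting_time (A' : set E) w}].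
Proof.
move=> mA.
(* The finite pieces of [lambda], normalized; the Dirac mass is the default for a zero piece. *)
pose mu n : probability E R :=
  mnormalize (sfinite_measure_seq lambda n) (\d_(@point E)).
have /choice[B BP] n : exists B : set 'rV[R]_d, [/\ Fsigma B, B `<=` A &
    {ae law P (mu n), forall w, hitting_time A w = hitting_time (B : set E) w}].
  apply: hitting_time_Fsigma_ae => //=; rewrite /law.
  rewrite (eq_integral (cst 1)) => [|y _]; last exact: prob_kernel.
  by rewrite integral_cst// mul1e [X in X < _](probability_setT (mu n)) ltry.
pose A' := \bigcup_n B n.
have A'A : A' `<=` A by apply: bigcup_sub => n _; have [] := BP n.
have /choice[Z ZP] n : exists Z : set Omega, [/\ measurable Z, law P (mu n) Z = 0 &
    [set w | hitting_time A w <> hitting_time (A' : set E) w] `<=` Z].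
  have [_ _ [Z [mZ Z0 subZ]]] := BP n.
  exists Z; split=> // w AA'; apply: subZ => /= AB; apply: AA'.
  apply/eqP; rewrite eq_le hitting_timeS//= AB hitting_timeS//.
  exact: bigcup_sup.
(* [Y] is measurable, contains the disagreement of the two hitting times, and is null from every
   initial law [mu n]. The points from which it is charged thus form a [lambda]-null set [N]. *)
pose Y := \bigcap_n Z n.
have mY : measurable Y by apply: bigcapT_measurable => n; have [] := ZP n.
pose N := [set y | P y Y != 0].
have mN : measurable N.
  by have := emeasurable_neq measurableT (measurable_kernel P Y mY) 0; rewrite setTI.
have N0 : lambda N = 0.
  rewrite sfinite_measure_seqP//; apply: eseries0 => n _ _.
  apply: (@mnormalize_eq0 _ _ _ _ (\d_(@point E))) => //.
  rewrite -[LHS]/(mu n N).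
  have : \int[mu n]_y P y Y = 0.
    have [mZ Z0 _] := ZP n.
    apply/eqP; rewrite eq_le integral_ge0 ?andbT// -Z0 /law.
    apply: ge0_le_integral => //.
    - exact: measurable_kernel.
    - exact: measurable_kernel.
    - by move=> y _; apply: le_measure; rewrite ?inE//; exact: bigcap_inf.
  move=> Y0.
  have : ae_eq (mu n) setT (fun y => P y Y) (cst 0).
    apply/ae_eq_integral_abs => //; first exact: measurable_kernel.
    by rewrite -[RHS]Y0; apply: eq_integral => y _; rewrite gee0_abs.
  move=> [M [mM M0 subM]]; apply/eqP; rewrite eq_le measure_ge0 andbT -M0.
  apply: le_measure; rewrite ?inE// => y yN; apply: subM => /= /(_ I) Py.
  by move: yN; rewrite /N/= Py eqxx.
exists A'; split=> //; first by apply: Fsigma_bigcup => n; have [] := BP n.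
move=> x.
(* At these times, which tend to 0, the path from [x] almost surely avoids [N]; by the Markov
   property the path shifted by any of them is almost surely outside [Y]. *)
have /choice[t tP] k : exists t : R, [/\ (0 <= t)%R, (t < k.+1%:R^-1)%R & Pt t x N = 0].
  by apply: null_transition_near0 => //; rewrite invr_gt0.
apply: (@negligibleS _ _ _ _ (\bigcup_k shift_path (t k) @^-1` Y)); last first.
  apply: negligible_bigcup => k; have [t0 _ tN] := tP k.
  have mYt : measurable (shift_path (t k) @^-1` Y).
    by rewrite -[X in measurable X]setTI; exact: measurable_shift_path.
  apply/negligibleP => //; rewrite [LHS](markov_property SM x t0 mY).
  rewrite (@ge0_ae_eq_integral _ _ _ _ _ _ (cst 0)) ?integral0//.
    exact: measurable_kernel.
  exists N; split=> // y /= nY; rewrite /N/=; apply/eqP => PY; exact: nY.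
move=> w /= AA'; apply: contrapT => nw; apply: AA'.
apply: eq_hitting_time_shift => // e e0.
have [k _ ke] : \forall n \near \oo, (n.+1%:R^-1 < e)%R.
  exact: near_infty_natSinv_lt (PosNum e0).
have [tk0 tke _] := tP k; exists (t k); split=> //.
  by rewrite (lt_trans tke)// ke/=.
apply: contrapT => AA'; apply: nw; exists k => // n _.
by have [_ _] := ZP n; apply.
Qed.

End reference.

(** * Thin sets and irregular points *)

Lemma ge0_integral_lebesgue_shift (R : realType) (c : R) (D : set R) (f : R -> \bar R) :
  measurable D -> measurable_fun setT f -> (forall t, 0 <= f t) ->
  \int[lebesgue_measure]_(t in [set t | D (c + t)%R]) f (c + t)%R =
  \int[lebesgue_measure]_(t in D) f t.
Proof.
move=> mD mf f0.
have mc : measurable_fun [set: measurableTypeR R] (fun t => c + t : measurableTypeR R)%R.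
  exact: (@measurable_funD _ _ _ setT (cst c) id).
rewrite -(@ge0_integral_pushforward _ _ _ _ _ _ mc lebesgue_measure D f)//; last first.
  exact: measurable_funTS.
apply/esym/eq_measure_integral => X mX _.
apply: lebesgue_measure_unique => // _ [[a b] /= _ <-].
rewrite /pushforward (_ : _ @^-1` _ = `](a - c)%R, (b - c)%R]%classic).
  by rewrite !lebesgue_measure_itv/= !lte_fin ltrD2r -!EFinB opprB addrA subrK.
by apply/seteqP; split=> t /=; rewrite !in_itv/= ltrBlDl lerBrDl.
Qed.

Lemma fubini_tonelli_in d1 d2 (T1 : measurableType d1) (T2 : measurableType d2)
    (R : realType) (m1 : {sigma_finite_measure set T1 -> \bar R})
    (m2 : {sigma_finite_measure set T2 -> \bar R}) (D1 : set T1) (D2 : set T2)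
    (f : T1 * T2 -> \bar R) :
  measurable D1 -> measurable D2 -> measurable_fun setT f -> (forall z, 0 <= f z) ->
  \int[m1]_(x in D1) \int[m2]_(y in D2) f (x, y) =
  \int[m2]_(y in D2) \int[m1]_(x in D1) f (x, y).
Proof.
move=> mD1 mD2 mf f0; pose g := f \_ (D1 `*` D2).
have mg : measurable_fun setT g.
  apply: (measurable_restrictT _ (measurableX mD1 mD2)).1; exact: measurable_funTS.
have g0 z : 0 <= g z by rewrite /g patchE; case: ifPn.
rewrite integral_mkcond [RHS]integral_mkcond.
transitivity (\int[m1]_x \int[m2]_y g (x, y)).
  apply: eq_integral => x _; rewrite patchE; case: ifPn => [|nx].
    rewrite inE => xD; rewrite integral_mkcond; apply: eq_integral => y _.
    rewrite /g !patchE; congr (if _ then _ else _); apply/idP/idP.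
      by move=> /set_mem yD; exact/mem_set.
    by move=> /set_mem[_ yD]; exact/mem_set.
  rewrite integral0_eq// => y _; rewrite /g patchE ifF//.
  by apply/negbTE; apply: contra nx => /set_mem[/= xD _]; exact/mem_set.
rewrite fubini_tonelli//; apply: eq_integral => y _.
rewrite [RHS]patchE; case: ifPn => [|ny].
  rewrite inE => yD; rewrite [RHS]integral_mkcond; apply: eq_integral => x _.
  rewrite /g !patchE; congr (if _ then _ else _); apply/idP/idP.
    by move=> /set_mem[xD _]; exact/mem_set.
  by move=> /set_mem xD; exact/mem_set.
rewrite integral0_eq// => x _; rewrite /g patchE ifF//.
by apply/negbTE; apply: contra ny => /set_mem[/= _ yD]; exact/mem_set.
Qed.

Section measurable_partial_integral.
Context d1 d2 (T1 : measurableType d1) (T2 : measurableType d2) (R : realType).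
Variable f : T1 * T2 -> \bar R.
Hypotheses (mf : measurable_fun setT f) (f0 : forall z, 0 <= f z).

Lemma measurable_integral_fst (m1 : {sigma_finite_measure set T1 -> \bar R})
    (D : set T1) : measurable D ->
  measurable_fun setT (fun y => \int[m1]_(x in D) f (x, y)).
Proof.
move=> mD; pose g := f \_ (D `*` setT).
have mg : measurable_fun setT g.
  apply: (measurable_restrictT _ (measurableX mD measurableT)).1.
  exact: measurable_funTS.
have g0 z : 0 <= g z by rewrite /g patchE; case: ifPn.
rewrite (_ : (fun y => _) = fubini_G m1 g); first exact: measurable_fun_fubini_tonelli_G.
apply/funext => y; rewrite /fubini_G [LHS]integral_mkcond; apply: eq_integral => x _.
rewrite /g !patchE; congr (if _ then _ else _); apply/idP/idP.
  by move=> /set_mem xD; exact/mem_set.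
by move=> /set_mem[xD _]; exact/mem_set.
Qed.

Lemma measurable_integral_snd (m2 : {sigma_finite_measure set T2 -> \bar R})
    (D : set T2) : measurable D ->
  measurable_fun setT (fun x => \int[m2]_(y in D) f (x, y)).
Proof.
move=> mD; pose g := f \_ (setT `*` D).
have mg : measurable_fun setT g.
  apply: (measurable_restrictT _ (measurableX measurableT mD)).1.
  exact: measurable_funTS.
have g0 z : 0 <= g z by rewrite /g patchE; case: ifPn.
rewrite (_ : (fun x => _) = fubini_F m2 g); first exact: measurable_fun_fubini_tonelli_F.
apply/funext => x; rewrite /fubini_F [LHS]integral_mkcond; apply: eq_integral => y _.
rewrite /g !patchE; congr (if _ then _ else _); apply/idP/idP.
  by move=> /set_mem yD; exact/mem_set.
by move=> /set_mem[_ yD]; exact/mem_set.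
Qed.

End measurable_partial_integral.

Section strong_markov_average.
Context (R : realType) (d : nat) (P : R.-pker (Rd R d) ~> (path_space R d)).
Local Notation E := (Rd R d).
Local Notation Omega := (path_space R d).
Variable Pt : R -> R.-pker E ~> E.
Hypothesis SM : strong_markov_process P Pt.
Variables (K : set 'rV[R]_d) (Kcl : closed K).
Local Notation T := (fun w : Omega => hitting_time (K : set E) w).

Let mT : measurable_fun [set: Omega] T.
Proof. exact: measurable_hitting_time (closed_Fsigma Kcl). Qed.

Let mfT : measurable_fun [set: Omega] (fun w => fine (T w)).
Proof. exact: (measurableT_comp (fine_measurable measurableT)). Qed.

Let mTlt (c : \bar R) : measurable [set w : Omega | T w < c].
Proof. by have := emeasurable_fun_infty_o measurableT mT c; rewrite setTI. Qed.

Lemma measurable_stopped_coord (t : R) :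
  measurable_fun [set: Omega] (fun w : Omega => w (fine (T w) + t)%R : E).
Proof.
apply: (measurableT_comp (@measurable_eval R d)
  (g := fun w : Omega => ((fine (T w) + t)%R, w))).
apply: measurable_fun_pair => //.
by apply: measurable_funD.
Qed.

Lemma measurable_transition_stopped (t : R) (U : set E) : measurable U ->
  measurable_fun [set: Omega] (fun w : Omega => Pt t (w (fine (T w))) U).
Proof.
move=> mU; apply: (measurableT_comp (measurable_kernel (Pt t) U mU)
  (g := fun w : Omega => w (fine (T w)) : E)).
have := @measurable_stopped_coord 0%R.
by under eq_fun do rewrite addr0.
Qed.

Lemma strong_markov_fun (x : E) (t : R) (g : E -> \bar R) : (0 <= t)%R ->
  measurable_fun setT g -> (forall y, 0 <= g y) ->
  \int[P x]_(w in [set w : Omega | T w < +oo]) g (w (fine (T w) + t)%R) =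
  \int[P x]_(w in [set w : Omega | T w < +oo]) \int[Pt t (w (fine (T w)))]_z g z.
Proof.
move=> t0 mg g0.
have mk U : measurable U ->
    measurable_fun [set: Omega] (fun w : Omega => Pt t (w (fine (T w))) U).
  exact: measurable_transition_stopped.
apply: (@integral_comp_mixture _ _ Omega E _ _ _ _
  (fun w : Omega => w (fine (T w) + t)%R) (fun w : Omega => Pt t (w (fine (T w))))) => //.
  exact: measurable_stopped_coord.
move=> U mU; have [_ _ sm] := SM.
have st := @stopping_time_closed _ _ P _ Kcl.
have := sm x _ setT t U st (stopped_eventsT st) t0 mU.
rewrite setTI completed_measure_extensionE/=; last first.
  apply: measurableI => //; rewrite -[X in measurable X]setTI.
  exact: measurable_stopped_coord.
by move=> ->; rewrite ge0_integral_completed//; exact: mk.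
Qed.

(** On [T < e] the window [[e, a]] lies in [[T, T + a]], so the integral of [g] along the path over
    it is at most the one over the times [T + t] with [t] in [[0, a]]. For each such [t], the strong
    Markov property bounds the mean by [q], as the path is in [K] at time [T]. Integrating over time
    absorbs the random shift. *)
Lemma strong_markov_average (x : E) (g : E -> \bar R) (q a e : R) :
  measurable_fun setT g -> (forall y, 0 <= g y) ->
  (0 <= q)%R -> (0 < e)%R -> (e < a)%R ->
  (forall y t, K y -> (0 <= t <= a)%R -> \int[Pt t y]_z g z <= q%:E) ->
  \int[lebesgue_measure]_(s in `[e, a])
    \int[P x]_(w in [set w : Omega | T w < e%:E]) g (w s)
  <= (q * a)%:E.
Proof.
move=> mg g0 q0 e0 ea gq.
have a0 : (0 < a)%R by exact: lt_trans ea.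
have m1 : measurable_fun setT (fun p : measurableTypeR R * Omega => g (p.2 p.1)).
  exact: (measurableT_comp mg (@measurable_eval R d)).
have m2 : measurable_fun setT
    (fun p : measurableTypeR R * Omega => g (p.2 (fine (T p.2) + p.1)%R)).
  apply: (measurableT_comp mg).
  apply: (measurableT_comp (@measurable_eval R d)
    (g := fun p : measurableTypeR R * Omega => ((fine (T p.2) + p.1)%R, p.2))).
  apply: measurable_fun_pair; last exact: measurable_snd.
  apply: measurable_funD; last exact: measurable_fst.
  exact: (measurableT_comp mfT measurable_snd).
have mI (b c : R) : measurable (`[b, c]%classic : set (measurableTypeR R)).
  exact: measurable_itv.
rewrite (@fubini_tonelli_in _ _ _ _ _ lebesgue_measure (kernel_law P x) _ _
  (fun p => g (p.2 p.1)))//=.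
apply: (@le_trans _ _ (\int[P x]_(w in [set w : Omega | T w < +oo])
    \int[lebesgue_measure]_(t in `[0%R, a]) g (w (fine (T w) + t)%R))).
  have mF := measurable_integral_fst m2 (fun p => g0 _) lebesgue_measure (mI 0%R a).
  have TS : [set w : Omega | T w < e%:E] `<=` [set w : Omega | T w < +oo].
    by move=> w /= /lt_trans; apply; rewrite ltry.
  apply: (@le_trans _ _ (\int[P x]_(w in [set w : Omega | T w < e%:E])
      \int[lebesgue_measure]_(t in `[0%R, a]) g (w (fine (T w) + t)%R))); last first.
    apply: ge0_subset_integral => //.
      exact: measurable_funTS.
    by move=> w _; apply: integral_ge0.
  apply: ge0_le_integral => //.
  - by move=> w _; apply: integral_ge0.
  - apply: measurable_funTS.
    exact: (measurable_integral_fst m1 (fun p => g0 _) lebesgue_measure (mI e a)).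
  - exact: measurable_funTS.
  - move=> w Te.
    have Tfin : T w \is a fin_num.
      by rewrite ge0_fin_numE ?hitting_time_ge0//; exact: TS.
    have T0 : (0 <= fine (T w))%R by rewrite fine_ge0// hitting_time_ge0.
    have Tfe : (fine (T w) < e)%R by rewrite -lte_fin fineK.
    have mgw : measurable_fun [set: measurableTypeR R] (fun t : R => g (w t)).
      exact: (measurableT_comp m1 (pair2_measurable w)).
    rewrite (_ : `[0%R, a]%classic =
        [set t | `[fine (T w), (fine (T w) + a)%R]%classic (fine (T w) + t)%R]);
        last first.
      by apply/seteqP; split=> t /=; rewrite !in_itv/= lerDl lerD2l.
    rewrite (@ge0_integral_lebesgue_shift _ _ _ (fun t => g (w t)))//.
    apply: ge0_subset_integral => //; first exact: measurable_funTS.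
    move=> t /=; rewrite !in_itv/= => /andP[et ta].
    by rewrite (le_trans (ltW Tfe) et) (le_trans ta)// lerDr.
rewrite -(@fubini_tonelli_in _ _ _ _ _ lebesgue_measure (kernel_law P x) _ _
  (fun p => g (p.2 (fine (T p.2) + p.1)%R)))//=.
apply: (@le_trans _ _ (\int[lebesgue_measure]_(t in `[0%R, a]) (cst q%:E) t)).
  apply: ge0_le_integral => //.
  - by move=> t _; apply: integral_ge0.
  - apply: measurable_funTS.
    exact: (measurable_integral_snd m2 (fun p => g0 _) (kernel_law P x) (mTlt +oo)).
  - move=> t /=; rewrite in_itv/= => /andP[t0 ta].
    rewrite -[leLHS]/(\int[P x]_(w in [set w : Omega | T w < +oo])
      g (w (fine (T w) + t)%R)).
    rewrite strong_markov_fun//.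
    apply: (@le_trans _ _ (\int[P x]_(w in [set w : Omega | T w < +oo]) (cst q%:E) w)).
      apply: ge0_le_integral => //.
      + by move=> w _; apply: integral_ge0.
      + apply: measurable_funTS; apply: measurable_fun_integral_kernel => //.
        exact: measurable_transition_stopped.
      + move=> w Tw; apply: gq; last by rewrite t0 ta.
        exact: closed_hitting_time.
    rewrite integral_cst// -[leRHS]mule1; apply: lee_wpmul2l; first by rewrite lee_fin.
    rewrite -(prob_kernel (s := P) x); apply: le_measure; rewrite ?inE//.
by rewrite integral_cst//= lebesgue_measure_itv/= lte_fin a0 sube0 EFinM.
Qed.

End strong_markov_average.

Section probability_kernel.
Context d d' (X : measurableType d) (Y : measurableType d') (R : realType).
Variables (k : R.-pker X ~> Y) (x : X).

Lemma prob_kernel_le1 (F : set Y) : measurable F -> k x F <= 1.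
Proof.
by move=> mF; rewrite -(prob_kernel (s := k) x); apply: le_measure; rewrite ?inE.
Qed.

Lemma prob_kernelC (F : set Y) : measurable F -> k x F + k x (~` F) = 1.
Proof.
move=> mF; rewrite -(prob_kernel (s := k) x) -(setUv F) measureU ?setICr//.
exact: measurableC.
Qed.

Lemma prob_kernel_ae (F : set Y) : measurable F ->
  {ae k x, forall y, F y} <-> k x F = 1.
Proof.
move=> mF; have mCF := measurableC mF; have := prob_kernelC mF.
split=> [/(negligibleP _ mCF) F0|F1]; first by move: H; rewrite F0 adde0.
apply/(negligibleP _ mCF); move: H; rewrite F1.
suff e (y : \bar R) : 1 + y = 1 -> y = 0 by exact: e.
by case: y => [r| |]//; rewrite -EFinD => -[] r0; have -> : r = 0%R by lra.
Qed.

End probability_kernel.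

Section irregular_points.
Context (R : realType) (d : nat) (P : R.-pker (Rd R d) ~> (path_space R d)).
Local Notation E := (Rd R d).
Local Notation Omega := (path_space R d).
Variable Pt : R -> R.-pker E ~> E.
Hypothesis SM : strong_markov_process P Pt.
Variable lambda : {sfinite_measure set E -> \bar R}.
Hypothesis lambda_ref : reference_measure Pt lambda.

Variables (A : set E) (A' : set 'rV[R]_d).
Hypotheses (mA : measurable A) (FA' : Fsigma A').
Hypothesis AA' : forall x,
  {ae P x, forall w, hitting_time A w = hitting_time (A' : set E) w}.

Let measurable_lt (B : set 'rV[R]_d) (c : R) : Fsigma B ->
  measurable [set w : Omega | hitting_time (B : set E) w < c%:E].
Proof.
move=> FB.
have := emeasurable_fun_infty_o measurableT (measurable_hitting_time FB) c%:E.
by rewrite setTI.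
Qed.

(** [A'] replaces [A] in the event to make it measurable. *)
Definition late_points (eta : R) : set E :=
  A `&` [set y | P y [set w | hitting_time (A' : set E) w < eta%:E] <= (1 - eta)%:E].

Lemma measurable_late_points (eta : R) : measurable (late_points eta).
Proof.
apply: measurableI => //.
have := emeasurable_fun_infty_c measurableT
  (measurable_kernel P _ (measurable_lt eta FA')) (1 - eta)%:E.
by rewrite setTI.
Qed.

Lemma regular_near_hit (x : E) (b c : R) : (0 < b)%R -> (0 < c)%R ->
  {ae P x, forall w, hitting_time (A' : set E) w = 0} ->
  exists2 a : R, (0 < a < b)%R & (1 - c)%:E < P x (hits a b A').
Proof.
move=> b0 c0 ae0.
(* These events increase, and their union contains every path that visits [A'] in []0, b[]; [k.+2]
   keeps the lower endpoint strictly below [b]. *)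
pose H k := hits (b / k.+2%:R) b A'.
have ab k : (0 < b / k.+2%:R < b)%R.
  by rewrite divr_gt0//= ltr_pdivrMr// ltr_pMr// ltr1n.
have mH k : measurable (H k).
  by apply: measurable_hits_Fsigma => //; have /andP[/ltW -> ->] := ab k.
have [| |k ck] := @exists_measure_gt _ _ _ (P x) H (1 - c)%:E mH.
- move=> k w [t /andP[kt tb] A't]; exists t => //; rewrite tb andbT.
  by apply: le_trans kt; rewrite ler_pM2l// lef_pV2 ?posrE// ler_nat.
- have mUH : measurable (\bigcup_k H k) by exact: bigcupT_measurable.
  rewrite ((prob_kernel_ae _ _ mUH).1 _); first by rewrite lte_fin ltrBlDr ltrDl.
  apply: filterS ae0 => w w0.
  have : hitting_time (A' : set E) w < b%:E by rewrite w0 lte_fin.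
  move=> /hitting_time_ltP[t [t0]]; rewrite lte_fin => tb A't.
  have [N _ NP] : \forall n \near \oo, (n.+1%:R^-1 < t / b)%R.
    by apply: near_infty_natSinv_lt (PosNum _); rewrite divr_gt0.
  exists N => //; exists t => //; rewrite (ltW tb) andbT mulrC -ler_pdivlMr//.
  by apply: ltW; apply: (NP N.+1) => /=.
- by exists (b / k.+2%:R)%R.
Qed.

(** A point [x] regular for the late points is regular for [A]. The mean of [g (w s)] on [F m],
    integrated over [s] in [[e, b]], would be at most [(1 - eta) b] by lateness and at least
    [(1 - 5/8 eta) (b - e)] by regularity, which is larger. *)
Lemma thin_late_points (eta : R) : (0 < eta <= 1)%R -> thin P (late_points eta).
Proof.
move=> /andP[eta0 eta1]; split; first exact: measurable_late_points.
apply/seteqP; split=> // x xreg.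
have [C [FC CL aeC]] := hitting_time_Fsigma SM lambda_ref (measurable_late_points eta).
have C0 : {ae P x, forall w, hitting_time (C : set E) w = 0}.
  by apply: filterS2 xreg (aeC x) => w -> <-.
have A'0 : {ae P x, forall w, hitting_time (A' : set E) w = 0}.
  apply: filterS2 xreg (AA' x) => w w0 <-; apply/eqP.
  rewrite eq_le hitting_time_ge0 andbT -w0; apply: hitting_timeS.
  by move=> y [].
have [K [Kcl Kinc CK]] := Fsigma_incr FC.
pose G := [set w : Omega | hitting_time (A' : set E) w < (eta / 2)%:E].
have mG : measurable G by exact: measurable_lt.
pose g (y : E) := P y G.
have mg : measurable_fun setT g by exact: measurable_kernel.
have g0 y : 0 <= g y by [].
have [|//|//|a /andP[a0 ab] aP] := @regular_near_hit x (eta / 4)%R (eta / 2)%R.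
- by rewrite divr_gt0.
- by rewrite divr_gt0.
(* As [b < a], visits from time [a] on are still ahead at every time [s <= b]. Discarding [[0, e]]
   costs only a fraction [eta / 8] of [b]. *)
pose b := (a / 2)%R; pose e := (b * (eta / 8))%R.
have b0 : (0 < b)%R by rewrite divr_gt0.
have e0 : (0 < e)%R by rewrite mulr_gt0// divr_gt0.
have eb : (e < b)%R by rewrite /e gtr_pMr//; lra.
pose F m := [set w : Omega | hitting_time (K m : set E) w < e%:E].
have mF m : measurable (F m) by apply: measurable_lt; exact: closed_Fsigma.
have [m mP] : exists m, (1 - eta / 8)%:E < P x (F m).
  apply: exists_measure_gt => //.
    by move=> m w /=; apply: le_lt_trans; apply: hitting_timeS; exact: Kinc.
  have mUF : measurable (\bigcup_m F m) by exact: bigcupT_measurable.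
  rewrite ((prob_kernel_ae _ _ mUF).1 _).
    by rewrite lte_fin ltrBlDr ltrDl divr_gt0.
  apply: filterS C0 => w w0.
  have : hitting_time (C : set E) w < e%:E by rewrite w0 lte_fin.
  rewrite CK => /hitting_time_ltP[t [t0 te [m _ Kt]]].
  by exists m => //; apply/hitting_time_ltP; exists t.
have mI (s t : R) : measurable (`[s, t]%classic : set (measurableTypeR R)).
  exact: measurable_itv.
have := @strong_markov_average _ _ _ _ SM _ (Kcl m) x g (1 - eta)%R b e mg g0.
(* Since [t <= b < eta / 8], a hit within [eta / 2] after time [t] is a hit within [eta], which has
   probability at most [1 - eta] from a late point. *)
have gq y t : K m y -> (0 <= t <= b)%R -> \int[Pt t y]_z g z <= (1 - eta)%:E.
  move=> Ky /andP[t0 tb].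
  have [_] : late_points eta y by apply: CL; rewrite CK; exists m.
  apply: le_trans; rewrite -(markov_property SM)//; apply: le_measure; rewrite ?inE.
  - by rewrite -[X in measurable X]setTI; exact: measurable_shift_path.
  - exact: measurable_lt.
  - move=> w /= Gw; apply: le_lt_trans (hitting_time_shift_le _ _ t0) _.
    have : t%:E + hitting_time (A' : set E) (shift_path t w) < t%:E + (eta / 2)%:E.
      by rewrite lteD2lE.
    move=> /lt_le_trans; apply; rewrite -EFinD lee_fin; rewrite /b in tb; lra.
have eta10 : (0 <= 1 - eta)%R by rewrite subr_ge0.
move=> /(_ eta10 e0 eb gq).
apply/negP; rewrite -ltNge.
(* This is [1 - eta / 2 - eta / 8]: the losses come from [h1] (regularity) and [h2] (complement of
   [F m]). *)
pose c := (1 - 5 / 8 * eta)%R.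
apply: (@lt_le_trans _ _ (\int[lebesgue_measure]_(s in `[e, b]) (cst c%:E) s)).
  rewrite integral_cst//= lebesgue_measure_itv/= lte_fin eb -EFinD -EFinM lte_fin.
  rewrite /c /e; nra.
have mev : measurable_fun setT (fun p : measurableTypeR R * Omega => g (p.2 p.1)).
  exact: (measurableT_comp mg (@measurable_eval R d)).
apply: ge0_le_integral => //.
- by move=> s _; rewrite lee_fin /c; lra.
- apply: measurable_funTS.
  exact: (measurable_integral_snd mev (fun p => g0 _) (kernel_law P x) (mF m)).
move=> s /=; rewrite in_itv/= => /andP[es sb].
have s0 : (0 <= s)%R by rewrite (le_trans (ltW e0)).
have mgs : measurable_fun setT (fun w : Omega => g (w s)).
  exact: (measurableT_comp mg (@measurable_coord R d s)).
have h1 : (1 - eta / 2)%:E <= \int[P x]_w g (w s).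
  rewrite -(integral_transition SM)//.
  rewrite -(markov_property SM)//; apply: (le_trans (ltW aP)).
  apply: le_measure; rewrite ?inE.
  - by apply: measurable_hits_Fsigma => //; rewrite (ltW a0).
  - by rewrite -[X in measurable X]setTI; exact: measurable_shift_path.
  - move=> w [t /andP[at' tb] A't]; rewrite /G/=.
    have st : (s < t)%R by rewrite /b in sb; lra.
    apply: le_lt_trans (shift_hitting_time_le s0 st A't) _.
    rewrite lte_fin; lra.
have h2 : \int[P x]_(w in ~` F m) g (w s) <= (eta / 8)%:E.
  have mCF := measurableC (mF m).
  apply: (@le_trans _ _ (\int[P x]_(w in ~` F m) (cst 1) w)).
    apply: ge0_le_integral => //.
      exact: measurable_funTS.
    by move=> w _; exact: prob_kernel_le1.
  rewrite integral_cst// mul1e.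
  have := prob_kernelC P x (mF m); move: mP.
  have : P x (F m) <= 1 by exact: prob_kernel_le1.
  have : P x (~` F m) <= 1 by exact: prob_kernel_le1.
  have : 0 <= P x (F m) by []. have : 0 <= P x (~` F m) by [].
  case: (P x (F m)) => [u| |]//; case: (P x (~` F m)) => [v| |]//.
  rewrite !lee_fin !lte_fin -EFinD => _ _ _ _ uP [] uv; lra.
move: h1; rewrite -(setUv (F m)) ge0_integral_setU//; first last.
- by apply/disj_setPS; rewrite setICr.
- by rewrite setUv.
- exact: measurableC.
move=> h1; have := le_trans h1 (leeD2l _ h2).
rewrite -leeBlDr//; apply: le_trans; rewrite -EFinD lee_fin /c; lra.
Qed.

(** If [y] in [A] is in no late set, hitting before [1/(N+1)] has probability above [1 - 1/(N+1)]
    for every [N]. By monotonicity in [N], hitting before any fixed [1/(n+1)] then has probability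
    1. *)
Lemma irregular_pointsE : A `\` regular_points P A = \bigcup_n late_points n.+1%:R^-1.
Proof.
have reg y : regular_points P A y <->
    {ae P y, forall w, hitting_time (A' : set E) w = 0}.
  split=> [ry|ry].
    by apply: filterS2 ry (AA' y) => w -> <-.
  by apply: filterS2 ry (AA' y) => w + -> => ->.
apply/seteqP; split=> y.
  move=> [Ay nr]; apply: contrapT => nl; apply: nr; apply/reg.
  have lt1 n : (1 - n.+1%:R^-1)%:E <
      P y [set w | hitting_time (A' : set E) w < (n.+1%:R^-1)%:E].
    by rewrite ltNge; apply/negP => le1; apply: nl; exists n.
  have ae_lt n : {ae P y, forall w, hitting_time (A' : set E) w < (n.+1%:R^-1)%:E}.
    have mn := measurable_lt n.+1%:R^-1 FA'.
    apply/(prob_kernel_ae _ _ mn).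
    apply/eqP; rewrite eq_le prob_kernel_le1//=.
    apply/lee_addgt0Pr => e e0.
    have [N _ NP] : \forall n \near \oo, (n.+1%:R^-1 < e)%R.
      exact: near_infty_natSinv_lt (PosNum e0).
    rewrite -leeBlDr//; apply: (@le_trans _ _ (1 - (maxn N n).+1%:R^-1)%:E).
      by rewrite -EFinD lee_fin lerD2l lerN2 ltW// NP/= ?leq_maxl.
    apply: (le_trans (ltW (lt1 _))); apply: le_measure; rewrite ?inE//.
      exact: measurable_lt.
    move=> w /= /lt_le_trans; apply; rewrite lee_fin lef_pV2 ?posrE// ler_nat ltnS.
    exact: leq_maxr.
  apply: filterS (ae_foralln ae_lt) => w wn.
  apply/eqP; rewrite eq_le hitting_time_ge0 andbT.
  apply/lee_addgt0Pr => e e0; rewrite add0e.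
  have [N _ NP] : \forall n \near \oo, (n.+1%:R^-1 < e)%R.
    exact: near_infty_natSinv_lt (PosNum e0).
  by apply: (le_trans (ltW (wn N))); rewrite lee_fin ltW// NP/=.
move=> [n _ [Ay le1]]; split=> // /reg ry.
have n0 : (0 < n.+1%:R^-1 :> R)%R by rewrite invr_gt0.
move: le1 => /=; rewrite ((prob_kernel_ae _ _ (measurable_lt n.+1%:R^-1 FA')).1 _).
  by rewrite lee_fin lerBrDr gerDl leNgt n0.
by apply: filterS ry => w w0 /=; rewrite w0 lte_fin.
Qed.

Lemma semipolar_irregular_points : semipolar P (A `\` regular_points P A).
Proof.
rewrite irregular_pointsE; exists (fun n => late_points n.+1%:R^-1) => // n.
by apply: thin_late_points; rewrite invr_gt0 ltr0n/= invf_le1// ler1n.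
Qed.

Lemma measurable_irregular_points : measurable (A `\` regular_points P A).
Proof.
rewrite irregular_pointsE; apply: bigcupT_measurable => n.
exact: measurable_late_points.
Qed.

End irregular_points.

(** * Expected payoffs *)

Section payoff.
Context (R : realType) (d : nat).
Local Notation E := (Rd R d).
Local Notation Omega := (path_space R d).
Context (f : 'rV[R]_d -> R) (delta : R -> R).
Hypotheses (fcont : continuous f) (f0 : forall x, (0 <= f x)%R).
Hypothesis Hdelta : discount_function delta.

Let delta_ge0 t : (0 <= t)%R -> (0 <= delta t)%R.
Proof. by have [_ + _ _ _] := Hdelta => h /h/andP[]. Qed.

Lemma measurable_payoff_function : measurable_fun [set: E] (fun y : E => f y).
Proof.
apply: (measurability _ (RGenOInfty.measurableE R)) => // _ [_ [r ->] <-].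
rewrite setTI; apply: measurable_open.
by apply: open_comp => [y _|]; [exact: fcont|exact: interval_open].
Qed.

Lemma measurable_discount_max0 :
  measurable_fun [set: R] (fun t => delta (Num.max t 0%R)).
Proof.
apply: nonincreasing_measurable => // s t st.
have [_ _ + _ _] := Hdelta; apply; first by rewrite le_max lexx orbT.
by rewrite ge_max le_max st le_max lexx !orbT.
Qed.

Lemma payoff_path_cont (w : Omega) :
  continuous (fun t : R => delta (Num.max t 0) * f (w t))%R.
Proof.
have [dc _ _ _ _] := Hdelta.
move=> t; apply: continuousM; first exact: (continuous_max0 dc).
by apply: continuous_comp; [exact: path_cont|exact: fcont].
Qed.

(** Half-lines beyond integers are cofinal among the neighbourhoods of [+oo], so a countable infimum
    suffices. *)
Lemma limsup_payoffE (w : Omega) :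
  limf_esup (fun r : R => (delta r * f (w r))%:E) +oo%R =
  ereal_inf [set ereal_sup [set (delta r * f (w r))%:E | r in [set r | (n%:R < r)%R]]
            | n in [set: nat]].
Proof.
apply/eqP; rewrite eq_le; apply/andP; split.
  apply: le_ereal_inf_tmp => _ [n _ <-]; apply: ereal_inf_lbound.
  exists [set r | (n%:R < r)%R] => //.
  by exists n%:R; split=> //; exact: num_real.
apply: le_ereal_inf_tmp => _ [V [M [_ MV]] <-].
apply: (@le_trans _ _ (ereal_sup
    [set (delta r * f (w r))%:E | r in [set r | ((Num.trunc `|M|).+1%:R < r)%R]])).
  by apply: ereal_inf_lbound; exists (Num.trunc `|M|).+1.
apply: ge_ereal_sup => _ [r /= Mr <-]; apply: ereal_sup_ubound; exists r => //.
apply: MV; apply: le_lt_trans Mr; apply: (le_trans (ler_norm M)).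
by rewrite ltW// truncnS_gt.
Qed.

(** By continuity, the supremum over the real times beyond [n] exceeds a level iff the payoff does
    so at some rational time. *)
Lemma measurable_limsup_payoff : measurable_fun [set: Omega]
  (fun w : Omega => limf_esup (fun r : R => (delta r * f (w r))%:E) +oo%R).
Proof.
under eq_fun do rewrite limsup_payoffE.
apply: (measurability _ (ErealGenInftyO.measurableE R)) => // _ [_ [c ->] <-].
pose S n (w : Omega) :=
  ereal_sup [set (delta r * f (w r))%:E | r in [set r : R | (n%:R < r)%R]].
rewrite setTI (_ : _ @^-1` _ = \bigcup_n [set w : Omega | S n w < c%:E]); last first.
  apply/seteqP; split=> w /=; rewrite in_itv/=.
    by move=> /ereal_inf_lt[_ [n _ <-] Sn]; exists n.
  by move=> [n _ /= Sn]; apply: le_lt_trans Sn; apply: ereal_inf_lbound; exists n.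
apply: bigcupT_measurable => n.
have mS : measurable_fun [set: Omega] (S n).
  apply: (measurability _ (ErealGenOInfty.measurableE R)) => // _ [_ [b ->] <-].
  rewrite setTI (_ : _ @^-1` _ = \bigcup_(q : rat) (if (n%:R < ratr q :> R)%R then
      [set w : Omega | (b < delta (ratr q) * f (w (ratr q)))%R] else set0)).
    apply: bigcupT_measurable_rat => q; case: ifPn => // _.
    rewrite -[X in measurable X]setTI.
    have := measurable_funM (measurable_cst (delta (ratr q)))
      (measurableT_comp measurable_payoff_function (@measurable_coord R d (ratr q))).
    move=> /(_ measurableT `]b, +oo[%classic (measurable_itv _)).
    by congr (measurable (_ `&` _)); apply/seteqP; split=> w /=; rewrite in_itv/= andbT.
  apply/seteqP; split=> w /=.
    rewrite in_itv/= andbT => /ereal_sup_gt[_ [r /= nr <-]]; rewrite lte_fin => br.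
    have r0 : (0 < r)%R by rewrite (le_lt_trans _ nr).
    have nr' : nbhs r [set s : R | (n%:R < s)%R].
      by apply: open_nbhs_nbhs; split => //; exact: open_gt.
    have br' : nbhs r [set s : R | (b < delta (Num.max s 0) * f (w s))%R].
      apply: (@payoff_path_cont w r [set z | (b < z)%R]).
      apply: open_nbhs_nbhs; split; first exact: open_gt.
      by rewrite /= max_l// ltW.
    have : nbhs r ([set s : R | (n%:R < s)%R] `&`
        [set s : R | (b < delta (Num.max s 0) * f (w s))%R]) by exact: filterI.
    move=> /nbhs_ballP[e /= e0 re].
    have [q] : exists q : rat, ratr q \in `](r - e)%R, (r + e)%R[.
      by apply: rat_in_itvoo; rewrite ltrBlDr -addrA ltrDl addr_gt0.
    rewrite in_itv/= => qe.
    have /re[/= nq] : ball r e (ratr q : R) by rewrite /ball/= distrC ltr_distl.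
    rewrite max_l; first by exists q; rewrite ?nq.
    by rewrite ltW// (le_lt_trans _ nq).
  move=> [q _]; case: ifPn => // nq /= bq; rewrite in_itv/= andbT.
  apply: (@lt_le_trans _ _ (delta (ratr q) * f (w (ratr q)))%:E) => //.
  by apply: ereal_sup_ubound; exists (ratr q).
by have := emeasurable_fun_infty_o measurableT mS c%:E; rewrite setTI.
Qed.

Lemma discounted_payoff_ge0 (t : \bar R) (w : Omega) : 0 <= t ->
  0 <= discounted_payoff f delta t w.
Proof.
case: t => [r|_|//].
  by rewrite lee_fin => r0; rewrite lee_fin mulr_ge0// delta_ge0.
rewrite /= limsup_payoffE; apply: le_ereal_inf_tmp => _ [n _ <-].
apply: (@le_trans _ _ (delta n.+1%:R * f (w n.+1%:R))%:E).
  by rewrite lee_fin mulr_ge0// delta_ge0.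
by apply: ereal_sup_ubound; exists n.+1%:R => //=; rewrite ltr_nat.
Qed.

Lemma measurable_discounted_payoff (B : set 'rV[R]_d) : Fsigma B ->
  measurable_fun [set: Omega]
    (fun w : Omega => discounted_payoff f delta (hitting_time (B : set E) w) w).
Proof.
move=> FB; have mB := measurable_hitting_time FB.
have mfB : measurable_fun [set: Omega]
    (fun w : Omega => fine (hitting_time (B : set E) w)).
  exact: (measurableT_comp (fine_measurable measurableT)).
(* Hitting times are nonnegative, so [Num.max], which makes the discount measurable on the whole
   line, changes no value. *)
rewrite (_ : (fun w => _) = (fun w : Omega =>
    if hitting_time (B : set E) w == +oo
    then limf_esup (fun r : R => (delta r * f (w r))%:E) +oo%R
    else (delta (Num.max (fine (hitting_time (B : set E) w)) 0)
          * f (w (fine (hitting_time (B : set E) w))))%:E)).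
  apply: measurable_fun_ifT.
  - by apply: measurable_fun_eqe.
  - exact: measurable_limsup_payoff.
  - apply/measurable_EFinP; apply: measurable_funM.
      exact: (measurableT_comp measurable_discount_max0 mfB).
    apply: (measurableT_comp measurable_payoff_function).
    apply: (measurableT_comp (@measurable_eval R d)
      (g := fun w : Omega => (fine (hitting_time (B : set E) w), w))).
    exact: measurable_fun_pair.
apply/funext => w; have := hitting_time_ge0 (B : set E) w.
by case: hitting_time => [r|//|//]; rewrite lee_fin => r0 /=; rewrite max_l.
Qed.

Variable P : R.-pker E ~> Omega.

(** The payoff at the hitting time of [A] agrees almost everywhere with the measurable one for [B];
    completeness makes it measurable with the same integral. *)
Lemma J_Fsigma (x : E) (A : set E) (B : set 'rV[R]_d) : Fsigma B ->
  {ae P x, forall w, hitting_time A w = hitting_time (B : set E) w} ->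
  J P f delta x A =
  \int[P x]_w discounted_payoff f delta (hitting_time (B : set E) w) w.
Proof.
move=> FB [M [mM M0 subM]]; rewrite /J /completed_expectation.
have mY := measurable_discounted_payoff FB.
have Y0 (C : set E) w : 0 <= discounted_payoff f delta (hitting_time C w) w.
  by apply: discounted_payoff_ge0; exact: hitting_time_ge0.
rewrite -ge0_integral_completed//.
have mYc : measurable_fun [set: caratheodory_type ((P x)^*)%mu]
    (fun w : Omega => discounted_payoff f delta (hitting_time (B : set E) w) w).
  move=> _ U mU; have := mY measurableT U mU; rewrite !setTI => mYU.
  exact: caratheodory_measurable_mu_ext.
have aeY : ae_eq (@completed_measure_extension _ _ _ (P x)) setT
    (fun w : Omega => discounted_payoff f delta (hitting_time (B : set E) w) w)
    (fun w : Omega => discounted_payoff f delta (hitting_time A w) w).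
  exists M; split.
  - exact: caratheodory_measurable_mu_ext.
  - by rewrite -M0; exact: completed_measure_extensionE.
  - by move=> w nY; apply: subM => /= AB; apply: nY => /= _; rewrite AB.
have cP : measure_is_complete (@completed_measure_extension _ _ _ (P x)).
  exact: measure_is_complete_caratheodory.
have mYA := ae_measurable_fun cP aeY mYc.
apply/esym; apply: (ge0_ae_eq_integral measurableT mYc mYA _ _ aeY).
  by move=> w _; exact: Y0.
by move=> w _; exact: Y0.
Qed.

Lemma J_regular (x : E) (A : set E) (B : set 'rV[R]_d) : Fsigma B ->
  {ae P x, forall w : Omega, w 0%R = x} ->
  {ae P x, forall w, hitting_time A w = hitting_time (B : set E) w} ->
  regular_points P A x -> J P f delta x A = (f x)%:E.
Proof.
move=> FB ae0 aeAB regA; rewrite (J_Fsigma FB aeAB).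
have [_ _ _ [d0 _] _] := Hdelta.
have aeY : ae_eq (P x) setT
    (fun w : Omega => discounted_payoff f delta (hitting_time (B : set E) w) w)
    (cst (f x)%:E).
  by apply: filterS3 ae0 aeAB regA => w w0 <- -> _; rewrite /= d0 mul1r w0.
rewrite (ge0_ae_eq_integral measurableT (measurable_discounted_payoff FB)
  (measurable_cst _) _ _ aeY).
- by rewrite integral_cst// -[X in _ * X]/(P x setT) prob_kernel mule1.
- by move=> w _; apply: discounted_payoff_ge0; exact: hitting_time_ge0.
- by move=> w _; rewrite lee_fin.
Qed.

End payoff.

(** * Equilibria *)

Section equilibria.
Context (R : realType) (d : nat) (P : R.-pker (Rd R d) ~> (path_space R d)).
Local Notation E := (Rd R d).
Local Notation Omega := (path_space R d).

Lemma polarS (A B : set E) : measurable B -> B `<=` A -> polar P A -> polar P B.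
Proof.
move=> mB BA [_ pA]; split=> // x; apply: filterS (pA x) => w Aoo.
by apply/eqP; rewrite -leye_eq -Aoo hitting_timeS.
Qed.

Lemma hitting_time_setD_polar (A B : set E) (x : E) : B `<=` A ->
  polar P (A `\` B) ->
  {ae P x, forall w, hitting_time B w = hitting_time A w}.
Proof.
move=> BA [_ /(_ x)]; apply: filterS => w Doo.
apply/eqP; rewrite eq_le; apply/andP; split; last exact: hitting_timeS.
apply: le_ereal_inf_tmp => _ [t [t0 At] <-].
have [Bt|nBt] := pselect (B (w t)); first exact: hitting_time_le.
have : hitting_time (A `\` B) w <= t%:E by exact: hitting_time_le.
by rewrite Doo leye_eq.
Qed.

End equilibria.

Unset Implicit Arguments.

Theorem proposition4p1 (R : realType) (d : nat)
    (Pt : R -> R.-pker (Rd R d) ~> (Rd R d))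
    (P : R.-pker (Rd R d) ~> (path_space R d))
    (f : 'rV[R]_d -> R) (delta : R -> R) :
  strong_markov_process P Pt ->
  continuous f -> (forall x, (0 <= f x)%R) ->
  discount_function delta ->
  (exists lambda : {sfinite_measure set (Rd R d) -> \bar R},
     reference_measure Pt lambda) ->
  (forall A : set (Rd R d), measurable A -> semipolar P A -> polar P A) ->
  (forall x : Rd R d,
     completed_expectation P x (fun w => ereal_sup
       [set discounted_payoff f delta t w | t in [set t : \bar R | 0 <= t]])
     < +oo) ->
  forall A : set (Rd R d), measurable A ->
    Theta P f delta A `<=` A ->
    [/\ polar P (A `\` Theta P f delta A),
        Theta P f delta (Theta P f delta A) = Theta P f delta A,
        equilibrium P f delta (Theta P f delta A) &
        finely_closed P A -> finely_closed P (Theta P f delta A)].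
Proof.
move=> SM fcont f0 Hdelta [lambda lambda_ref] hunt _ A mA TA.
have [A' [FA' A'A aeA]] := hitting_time_Fsigma SM lambda_ref mA.
have [_ start _] := SM.
set B := Theta P f delta A in TA *.
(* Through [A'], [J] becomes the integral of one measurable function against the kernel [P]. *)
have mJ : measurable_fun [set: Rd R d] (fun x => J P f delta x A).
  rewrite (_ : (fun x => _) = fun x => \int[P x]_w
      discounted_payoff f delta (hitting_time (A' : set (Rd R d)) w) w).
    apply: measurable_fun_integral_kernel.
    - by move=> U mU; exact: measurable_kernel.
    - by move=> w; apply: (discounted_payoff_ge0 f0 Hdelta); exact: hitting_time_ge0.
    - exact: (measurable_discounted_payoff fcont Hdelta FA').
  by apply/funext => x; rewrite (J_Fsigma fcont f0 Hdelta FA' (aeA x)).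
have mf : measurable_fun [set: Rd R d] (fun x => (f x)%:E).
  by apply/measurable_EFinP; exact: measurable_payoff_function.
have mB : measurable B.
  apply: measurableU; last apply: measurableI => //.
    by have := measurable_lte measurableT mJ mf; rewrite setTI.
  by have := measurable_eqe measurableT mJ mf; rewrite setTI.
have Jreg x : regular_points P A x -> J P f delta x A = (f x)%:E.
  exact: (J_regular fcont f0 Hdelta FA' (start x) (aeA x)).
(* Hunt's hypothesis enters here, on the irregular points of [A]. *)
have polAB : polar P (A `\` B).
  apply: (@polarS _ _ _ (A `\` regular_points P A)).
  - exact: measurableD.
  - move=> x [Ax nBx]; split=> // /Jreg Jx; apply: nBx; right; split=> //.
  - apply: hunt.
      exact: (measurable_irregular_points mA FA' aeA).
    exact: (semipolar_irregular_points SM lambda_ref mA FA' aeA).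
have aeB x := hitting_time_setD_polar x TA polAB.
have JB x : J P f delta x B = J P f delta x A.
  rewrite !(J_Fsigma fcont f0 Hdelta FA')//.
  by apply: filterS2 (aeB x) (aeA x) => w ->.
(* The two regions depend on the set only through [J], so those of [B] are those of [A]. *)
have TB : Theta P f delta B = B.
  apply/seteqP; split=> x.
    rewrite /Theta /stopping_region /indifference_region /=.
    rewrite JB => -[Jlt|[Jeq Bx]]; [by left|exact: Bx].
  move=> Bx; rewrite /Theta /stopping_region /indifference_region /= JB.
  by have [Jlt|[Jeq _]] : Theta P f delta A x := Bx; [left|right].
split=> //.
(* A point regular for [B] is regular for [A], hence indifferent, and it lies in [A] because [A] is
   finely closed. *)
move=> [_ Afc]; split=> //; apply/seteqP; split=> x; first by left.
move=> [//|Breg]; have Areg : regular_points P A x.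
  by apply: filterS2 Breg (aeB x) => w -> <-.
by right; split; [exact: Jreg|rewrite Afc; right].
Qed.
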